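(* Let $\Bbbk$ be an algebraically closed field of characteristic zero and let $\mathfrak{C}$ be a semisimple 2-category (respectively, a finite semisimple 2-category) over $\Bbbk$. Then there exists a strict semisimple 2-category (respectively, a strict finite semisimple 2-category), in the sense of Douglas-Reutter, that is linearly 2-equivalent to $\mathfrak{C}$.
   Context: Fix an algebraically closed field $\Bbbk$ of characteristic zero. 2-categories and 2-functors are weak (bicategories, pseudofunctors) unless called strict. Composition of 1-morphisms and horizontal composition of 2-morphisms is written $\circ$; vertical composition is written $\cdot$; coherence isomorphisms are suppressed. ''Locally $P$'' means that every $Hom$-category has property $P$. A 2-condensation monad in a 2-category consists of an object $A$, a 1-morphism $e:A\to A$, and 2-morphisms $\mu:e\circ e\Rightarrow e$, $\delta:e\Rightarrow e\circ e$ such that $(e,\mu)$ is a (non-unital) associative algebra, $(e,\delta)$ is a (non-counital) coassociative coalgebra, $\delta$ is an $(e,e)$-bimodule map, and $\mu\cdot\delta=Id_e$. A 2-condensation consists of objects $A,B$, 1-morphisms $f:A\to B$, $g:B\to A$, and 2-morphisms $\phi:f\circ g\Rightarrow Id_B$, $\gamma:Id_B\Rightarrow f\circ g$ with $\phi\cdot\gamma=Id_{Id_B}$. An extension of $(A,e,\mu,\delta)$ to a 2-condensation is a 2-condensation $(A,B,f,g,\phi,\gamma)$ with a 2-isomorphism $\theta:g\circ f\cong e$ such that $\mu=\theta\cdot(g\circ\phi\circ f)\cdot(\theta^{-1}\circ\theta^{-1})$ and $\delta=(\theta\circ\theta)\cdot(g\circ\gamma\circ f)\cdot\theta^{-1}$.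 A 2-category has all condensates if it is locally idempotent complete and every 2-condensation monad can be extended to a 2-condensation. A $\Bbbk$-linear 2-category is Cauchy complete if it has all condensates, is locally additive, and has all (finite) direct sums of objects. A semisimple 2-category is a $\Bbbk$-linear 2-category that is locally semisimple, has adjoints for 1-morphisms, and is Cauchy complete. An object $C$ is simple if the monoidal unit of $End_{\mathfrak{C}}(C)$ is a simple object. A finite semisimple 2-category is a semisimple 2-category that is locally finite semisimple and has only finitely many equivalence classes of simple objects. Strict (finite) semisimple 2-categories in the sense of Douglas-Reutter: a strict semisimple 2-category is a $\Bbbk$-linear strict 2-category that is locally semisimple, has adjoints for 1-morphisms, and is additive (locally additive with finite direct sums of objects) and idempotent complete. Here idempotent complete means locally idempotent complete and such that every separable monad is separably split, where a separable monad on an object $A$ is a unital associative algebra $p$ in $End(A)$ whose multiplication $p\circ p\Rightarrow p$ admits a section as a $(p,p)$-bimodule map, and it is separably split if there is an adjunction $f\dashv g$ with $f:A\to B$, $g:B\to A$ whose counit $f\circ g\Rightarrow Id_B$ admits a section, together with an isomorphism of monads $g\circ f\cong p$. It is finite if it is locally finite semisimple and has finitely many equivalence classes of simple objects. *)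

(* Defs.v *)
From mathcomp Require Import all_boot all_order all_algebra.

Set Implicit Arguments.
Unset Strict Implicit.
Unset Printing Implicit Defensive.

Import GRing.Theory.
Local Open Scope ring_scope.

(* Compositions are in the classical order: g \c f is "f, then g".
   \v : vertical composition of 2-morphisms (composition in a 1-category),
   \c : composition of 1-morphisms,  \h : horizontal composition of 2-morphisms. *)
Reserved Notation "b \v a" (at level 49, left associativity).
Reserved Notation "g \c f" (at level 40, left associativity).
Reserved Notation "b \h a" (at level 40, left associativity).

Record lincat (k : fieldType) := LinCat {
  obj :> Type;
  mor : obj -> obj -> lmodType k;
  idm : forall x, mor x x;
  vcomp : forall x y z, mor y z -> mor x y -> mor x z;
  vcomp1m : forall x y (a : mor x y), vcomp (idm y) a = a;
  vcompm1 : forall x y (a : mor x y), vcomp a (idm x) = a;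
  vcompA : forall x y z w (c : mor z w) (b : mor y z) (a : mor x y),
    vcomp c (vcomp b a) = vcomp (vcomp c b) a;
  vcomp_linear_l : forall x y z (a : mor x y),
    linear (fun b : mor y z => vcomp b a);
  vcomp_linear_r : forall x y z (b : mor y z),
    linear (fun a : mor x y => vcomp b a)
}.

Arguments mor {k l} _ _.
Arguments idm {k l} _.
Arguments vcomp {k l x y z} _ _.

Notation "b \v a" := (vcomp b a).

Record iso (k : fieldType) (X : lincat k) (x y : X) := Iso {
  fwd : mor x y;
  bwd : mor y x;
  fwdK : bwd \v fwd = idm x;
  bwdK : fwd \v bwd = idm y
}.

Definition isomorphic (k : fieldType) (X : lincat k) (x y : X) : Prop :=
  inhabited (iso x y).

Definition is_zero (k : fieldType) (X : lincat k) (x : X) : Prop :=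
  idm x = 0.

(* s is a direct sum of the finite family x; for n = 0 this says that s is a
   zero object. *)
Definition is_dirsum (k : fieldType) (X : lincat k) (n : nat)
    (x : 'I_n -> X) (s : X) : Prop :=
  exists (i : forall a, mor (x a) s) (p : forall a, mor s (x a)),
    [/\ forall a, p a \v i a = idm (x a),
        forall a b, a <> b -> p a \v i b = 0
      & \sum_(a < n) (i a \v p a) = idm s].

Definition additive_cat (k : fieldType) (X : lincat k) : Prop :=
  forall (n : nat) (x : 'I_n -> X), exists s : X, is_dirsum x s.

Definition idempotent_complete_cat (k : fieldType) (X : lincat k) : Prop :=
  forall (x : X) (p : mor x x), p \v p = p ->
  exists (y : X) (r : mor x y) (s : mor y x), r \v s = idm y /\ s \v r = p.

Definition mono (k : fieldType) (X : lincat k) (x y : X) (m : mor x y) : Prop :=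
  forall (z : X) (a b : mor z x), m \v a = m \v b -> a = b.

Definition epi (k : fieldType) (X : lincat k) (x y : X) (m : mor x y) : Prop :=
  forall (z : X) (a b : mor y z), a \v m = b \v m -> a = b.

Definition is_iso (k : fieldType) (X : lincat k) (x y : X) (m : mor x y) : Prop :=
  exists m' : mor y x, m' \v m = idm x /\ m \v m' = idm y.

Definition is_kernel (k : fieldType) (X : lincat k) (x y z : X)
    (f : mor x y) (m : mor z x) : Prop :=
  f \v m = 0 /\
  forall (w : X) (h : mor w x), f \v h = 0 -> exists! u : mor w z, m \v u = h.

Definition is_cokernel (k : fieldType) (X : lincat k) (x y z : X)
    (f : mor x y) (q : mor y z) : Prop :=
  q \v f = 0 /\
  forall (w : X) (h : mor y w), h \v f = 0 -> exists! u : mor z w, u \v q = h.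

Definition abelian_cat (k : fieldType) (X : lincat k) : Prop :=
  additive_cat X /\
  [/\ forall (x y : X) (f : mor x y), exists (z : X) (m : mor z x), is_kernel f m,
      forall (x y : X) (f : mor x y), exists (z : X) (q : mor y z), is_cokernel f q,
      forall (z x : X) (m : mor z x), mono m ->
        exists (y : X) (f : mor x y), is_kernel f m
    & forall (y z : X) (q : mor y z), epi q ->
        exists (x : X) (f : mor x y), is_cokernel f q].

Definition simple_in (k : fieldType) (X : lincat k) (x : X) : Prop :=
  ~ is_zero x /\
  forall (y : X) (m : mor y x), mono m -> is_zero y \/ is_iso m.

Definition semisimple_cat (k : fieldType) (X : lincat k) : Prop :=
  abelian_cat X /\
  forall x : X, exists (n : nat) (s : 'I_n -> X),
    (forall a, simple_in (s a)) /\ is_dirsum s x.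

Definition findim (k : fieldType) (V : lmodType k) : Prop :=
  exists (n : nat) (b : 'I_n -> V), forall v : V,
  exists c : 'I_n -> k, v = \sum_(i < n) c i *: b i.

Definition finite_semisimple_cat (k : fieldType) (X : lincat k) : Prop :=
  [/\ semisimple_cat X,
      forall x y : X, findim (mor x y)
    & exists (n : nat) (S : 'I_n -> X),
        forall x : X, simple_in x -> exists i, isomorphic x (S i)].

Record bicat (k : fieldType) := Bicat {
  Ob :> Type;
  Hom : Ob -> Ob -> lincat k;
  id1 : forall A, Hom A A;
  comp1 : forall A B C, Hom B C -> Hom A B -> Hom A C;
  comp2 : forall A B C (g g' : Hom B C) (f f' : Hom A B),
    mor g g' -> mor f f' -> mor (comp1 g f) (comp1 g' f');
  comp2_linear_l : forall A B C (g g' : Hom B C) (f f' : Hom A B) (a : mor f f'),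
    linear (fun b : mor g g' => comp2 b a);
  comp2_linear_r : forall A B C (g g' : Hom B C) (f f' : Hom A B) (b : mor g g'),
    linear (fun a : mor f f' => comp2 b a);
  comp2_id : forall A B C (g : Hom B C) (f : Hom A B),
    comp2 (idm g) (idm f) = idm (comp1 g f);
  interchange : forall A B C (g g' g'' : Hom B C) (f f' f'' : Hom A B)
      (b' : mor g' g'') (b : mor g g') (a' : mor f' f'') (a : mor f f'),
    comp2 (b' \v b) (a' \v a) = comp2 b' a' \v comp2 b a;
  assoc : forall A B C D (h : Hom C D) (g : Hom B C) (f : Hom A B),
    iso (comp1 (comp1 h g) f) (comp1 h (comp1 g f));
  lunit : forall A B (f : Hom A B), iso (comp1 (id1 B) f) f;
  runit : forall A B (f : Hom A B), iso (comp1 f (id1 A)) f;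
  assoc_nat : forall A B C D (h h' : Hom C D) (g g' : Hom B C) (f f' : Hom A B)
      (c : mor h h') (b : mor g g') (a : mor f f'),
    fwd (assoc h' g' f') \v comp2 (comp2 c b) a
      = comp2 c (comp2 b a) \v fwd (assoc h g f);
  lunit_nat : forall A B (f f' : Hom A B) (a : mor f f'),
    fwd (lunit f') \v comp2 (idm (id1 B)) a = a \v fwd (lunit f);
  runit_nat : forall A B (f f' : Hom A B) (a : mor f f'),
    fwd (runit f') \v comp2 a (idm (id1 A)) = a \v fwd (runit f);
  pentagon : forall A B C D E (l : Hom D E) (h : Hom C D) (g : Hom B C)
      (f : Hom A B),
    fwd (assoc l h (comp1 g f)) \v fwd (assoc (comp1 l h) g f)
      = comp2 (idm l) (fwd (assoc h g f)) \v fwd (assoc l (comp1 h g) f)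
        \v comp2 (fwd (assoc l h g)) (idm f);
  triangle : forall A B C (g : Hom B C) (f : Hom A B),
    comp2 (idm g) (fwd (lunit f)) \v fwd (assoc g (id1 B) f)
      = comp2 (fwd (runit g)) (idm f)
}.

Arguments Hom {k _} _ _.
Arguments id1 {k _} _.
Arguments comp1 {k _ A B C} _ _.
Arguments comp2 {k _ A B C g g' f f'} _ _.
Arguments assoc {k _ A B C D} h g f.
Arguments lunit {k _ A B} f.
Arguments runit {k _ A B} f.

Notation "g \c f" := (comp1 g f).
Notation "b \h a" := (comp2 b a).

Definition eqmor (k : fieldType) (X : lincat k) (x y : X) (e : x = y) : mor x y :=
  match e in _ = z return mor x z with erefl => idm x end.

(* A strict 2-category is a 2-category whose coherence isomorphisms are
   identities. *)
Definition strict (k : fieldType) (C : bicat k) : Prop :=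
  [/\ forall (A B D E : C) (h : Hom D E) (g : Hom B D) (f : Hom A B),
        exists e : h \c g \c f = h \c (g \c f), fwd (assoc h g f) = eqmor e,
      forall (A B : C) (f : Hom A B),
        exists e : id1 B \c f = f, fwd (lunit f) = eqmor e
    & forall (A B : C) (f : Hom A B),
        exists e : f \c id1 A = f, fwd (runit f) = eqmor e].

Definition locally (k : fieldType) (P : lincat k -> Prop) (C : bicat k) : Prop :=
  forall A B : C, P (Hom A B).

Definition equivalence1 (k : fieldType) (C : bicat k) (A B : C) (f : Hom A B) : Prop :=
  exists g : Hom B A, isomorphic (g \c f) (id1 A) /\ isomorphic (f \c g) (id1 B).

Definition equivalent (k : fieldType) (C : bicat k) (A B : C) : Prop :=
  exists f : Hom A B, equivalence1 f.

Record adjunction (k : fieldType) (C : bicat k) (A B : C)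
    (f : Hom A B) (g : Hom B A) := Adjunction {
  adj_unit : mor (id1 A) (g \c f);
  adj_counit : mor (f \c g) (id1 B);
  adj_zigzag_l :
    fwd (lunit f) \v (adj_counit \h idm f) \v bwd (assoc f g f)
      \v (idm f \h adj_unit) \v bwd (runit f) = idm f;
  adj_zigzag_r :
    fwd (runit g) \v (idm g \h adj_counit) \v fwd (assoc g f g)
      \v (adj_unit \h idm g) \v bwd (lunit g) = idm g
}.

Definition has_adjoints (k : fieldType) (C : bicat k) : Prop :=
  forall (A B : C) (f : Hom A B),
    (exists g : Hom B A, inhabited (adjunction f g)) /\
    (exists g : Hom B A, inhabited (adjunction g f)).

(* For n = 0 the last clause says that the identity of S is a zero object of
   Hom S S, i.e. that S is a zero object. *)
Definition is_obj_dirsum (k : fieldType) (C : bicat k) (n : nat)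
    (A : 'I_n -> C) (S : C) : Prop :=
  exists (i : forall a, Hom (A a) S) (p : forall a, Hom S (A a)),
    [/\ forall a, isomorphic (p a \c i a) (id1 (A a)),
        forall a b, a <> b -> is_zero (p a \c i b)
      & is_dirsum (fun a => i a \c p a) (id1 S)].

Definition has_obj_dirsums (k : fieldType) (C : bicat k) : Prop :=
  forall (n : nat) (A : 'I_n -> C), exists S : C, is_obj_dirsum A S.

Definition rebracket (k : fieldType) (C : bicat k) (A B : C)
    (f f' : Hom A B) (g g' : Hom B A) :
    mor ((g \c f) \c (g' \c f')) (g \c ((f \c g') \c f')) :=
  (idm g \h bwd (assoc f g' f')) \v fwd (assoc g f (g' \c f')).

Definition rebracketV (k : fieldType) (C : bicat k) (A B : C)
    (f f' : Hom A B) (g g' : Hom B A) :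
    mor (g \c ((f \c g') \c f')) ((g \c f) \c (g' \c f')) :=
  bwd (assoc g f (g' \c f')) \v (idm g \h fwd (assoc f g' f')).

(* The 2-morphisms "g o phi o f" and "g o gamma o f" with coherence
   isomorphisms made explicit. *)
Definition whisk_in (k : fieldType) (C : bicat k) (A B : C)
    (f : Hom A B) (g : Hom B A) (phi : mor (f \c g) (id1 B)) :
    mor ((g \c f) \c (g \c f)) (g \c f) :=
  (idm g \h (fwd (lunit f) \v (phi \h idm f))) \v rebracket f f g g.

Definition whisk_out (k : fieldType) (C : bicat k) (A B : C)
    (f : Hom A B) (g : Hom B A) (gamma : mor (id1 B) (f \c g)) :
    mor (g \c f) ((g \c f) \c (g \c f)) :=
  rebracketV f f g g \v (idm g \h ((gamma \h idm f) \v bwd (lunit f))).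

Definition associative_mul (k : fieldType) (C : bicat k) (A : C) (e : Hom A A)
    (mu : mor (e \c e) e) : Prop :=
  mu \v (mu \h idm e) = mu \v (idm e \h mu) \v fwd (assoc e e e).

Definition coassociative_comul (k : fieldType) (C : bicat k) (A : C) (e : Hom A A)
    (delta : mor e (e \c e)) : Prop :=
  fwd (assoc e e e) \v (delta \h idm e) \v delta = (idm e \h delta) \v delta.

(* e o e carries the left action of its left factor and the right action of
   its right factor; the two clauses are left and right equivariance. *)
Definition bimodule_map (k : fieldType) (C : bicat k) (A : C) (e : Hom A A)
    (mu : mor (e \c e) e) (delta : mor e (e \c e)) : Prop :=
  delta \v mu = (mu \h idm e) \v bwd (assoc e e e) \v (idm e \h delta) /\
  delta \v mu = (idm e \h mu) \v fwd (assoc e e e) \v (delta \h idm e).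

Record cond_monad (k : fieldType) (C : bicat k) := CondMonad {
  cm_obj : C;
  cm_e : Hom cm_obj cm_obj;
  cm_mu : mor (cm_e \c cm_e) cm_e;
  cm_delta : mor cm_e (cm_e \c cm_e);
  cm_assoc : associative_mul cm_mu;
  cm_coassoc : coassociative_comul cm_delta;
  cm_bimod : bimodule_map cm_mu cm_delta;
  cm_section : cm_mu \v cm_delta = idm cm_e
}.

Record condensation (k : fieldType) (C : bicat k) (A B : C) := Condensation {
  cd_f : Hom A B;
  cd_g : Hom B A;
  cd_phi : mor (cd_f \c cd_g) (id1 B);
  cd_gamma : mor (id1 B) (cd_f \c cd_g);
  cd_section : cd_phi \v cd_gamma = idm (id1 B)
}.

Definition extends_to (k : fieldType) (C : bicat k) (M : cond_monad C) (B : C)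
    (X : condensation (cm_obj M) B) : Prop :=
  exists theta : iso (cd_g X \c cd_f X) (cm_e M),
    cm_mu M = fwd theta \v whisk_in (cd_phi X) \v (bwd theta \h bwd theta) /\
    cm_delta M = (fwd theta \h fwd theta) \v whisk_out (cd_gamma X) \v bwd theta.

Definition has_condensates (k : fieldType) (C : bicat k) : Prop :=
  locally (@idempotent_complete_cat k) C /\
  forall M : cond_monad C,
  exists (B : C) (X : condensation (cm_obj M) B), extends_to X.

Definition cauchy_complete (k : fieldType) (C : bicat k) : Prop :=
  [/\ has_condensates C, locally (@additive_cat k) C & has_obj_dirsums C].

Definition is_monad (k : fieldType) (C : bicat k) (A : C) (p : Hom A A)
    (m : mor (p \c p) p) (u : mor (id1 A) p) : Prop :=
  [/\ associative_mul m,
      m \v (u \h idm p) = fwd (lunit p)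
    & m \v (idm p \h u) = fwd (runit p)].

Definition separable (k : fieldType) (C : bicat k) (A : C) (p : Hom A A)
    (m : mor (p \c p) p) : Prop :=
  exists d : mor p (p \c p), bimodule_map m d /\ m \v d = idm p.

(* The monad of an adjunction f -| g has underlying 1-morphism g o f,
   multiplication g o counit o f and unit the unit of the adjunction; theta is
   an isomorphism of monads from it to p. *)
Definition separably_split (k : fieldType) (C : bicat k) (A : C) (p : Hom A A)
    (m : mor (p \c p) p) (u : mor (id1 A) p) : Prop :=
  exists (B : C) (f : Hom A B) (g : Hom B A) (adj : adjunction f g),
    (exists s : mor (id1 B) (f \c g), adj_counit adj \v s = idm (id1 B)) /\
    (exists theta : iso (g \c f) p,
       fwd theta \v whisk_in (adj_counit adj) = m \v (fwd theta \h fwd theta) /\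
       fwd theta \v adj_unit adj = u).

Definition idempotent_complete2 (k : fieldType) (C : bicat k) : Prop :=
  locally (@idempotent_complete_cat k) C /\
  forall (A : C) (p : Hom A A) (m : mor (p \c p) p) (u : mor (id1 A) p),
    is_monad m u -> separable m -> separably_split m u.

Definition simple_obj (k : fieldType) (C : bicat k) (A : C) : Prop :=
  simple_in (id1 A).

Definition finitely_many_simples (k : fieldType) (C : bicat k) : Prop :=
  exists (n : nat) (S : 'I_n -> C),
    forall A : C, simple_obj A -> exists i, equivalent A (S i).

Definition semisimple2 (k : fieldType) (C : bicat k) : Prop :=
  [/\ locally (@semisimple_cat k) C, has_adjoints C & cauchy_complete C].

Definition finite_semisimple2 (k : fieldType) (C : bicat k) : Prop :=
  [/\ semisimple2 C,
      locally (@finite_semisimple_cat k) C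
    & finitely_many_simples C].

Definition strict_semisimple2 (k : fieldType) (C : bicat k) : Prop :=
  strict C /\
  [/\ locally (@semisimple_cat k) C,
      has_adjoints C,
      locally (@additive_cat k) C,
      has_obj_dirsums C
    & idempotent_complete2 C].

Definition strict_finite_semisimple2 (k : fieldType) (C : bicat k) : Prop :=
  [/\ strict_semisimple2 C,
      locally (@finite_semisimple_cat k) C
    & finitely_many_simples C].

Record linfunctor (k : fieldType) (X Y : lincat k) := LinFunctor {
  fobj :> X -> Y;
  fmor : forall x y : X, mor x y -> mor (fobj x) (fobj y);
  fmor_linear : forall x y : X, linear (@fmor x y);
  fmor_id : forall x : X, fmor (idm x) = idm (fobj x);
  fmor_comp : forall (x y z : X) (b : mor y z) (a : mor x y),
    fmor (b \v a) = fmor b \v fmor a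
}.

Arguments fmor {k X Y} _ {x y} _.

Lemma fmap_iso_fwdK (k : fieldType) (X Y : lincat k) (F : linfunctor X Y)
    (x y : X) (t : iso x y) : fmor F (bwd t) \v fmor F (fwd t) = idm (F x).
Proof. by rewrite -fmor_comp fwdK fmor_id. Qed.

Lemma fmap_iso_bwdK (k : fieldType) (X Y : lincat k) (F : linfunctor X Y)
    (x y : X) (t : iso x y) : fmor F (fwd t) \v fmor F (bwd t) = idm (F y).
Proof. by rewrite -fmor_comp bwdK fmor_id. Qed.

Definition fmap_iso (k : fieldType) (X Y : lincat k) (F : linfunctor X Y)
    (x y : X) (t : iso x y) : iso (F x) (F y) :=
  Iso (fmap_iso_fwdK F t) (fmap_iso_bwdK F t).

Lemma comp_iso_fwdK (k : fieldType) (X : lincat k) (x y z : X)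
    (t : iso y z) (s : iso x y) :
  (bwd s \v bwd t) \v (fwd t \v fwd s) = idm x.
Proof.
by rewrite -vcompA [bwd t \v _]vcompA fwdK vcomp1m fwdK.
Qed.

Lemma comp_iso_bwdK (k : fieldType) (X : lincat k) (x y z : X)
    (t : iso y z) (s : iso x y) :
  (fwd t \v fwd s) \v (bwd s \v bwd t) = idm z.
Proof.
by rewrite -vcompA [fwd s \v _]vcompA bwdK vcomp1m bwdK.
Qed.

Definition comp_iso (k : fieldType) (X : lincat k) (x y z : X)
    (t : iso y z) (s : iso x y) : iso x z :=
  Iso (comp_iso_fwdK t s) (comp_iso_bwdK t s).

Definition id_iso (k : fieldType) (X : lincat k) (x : X) : iso x x :=
  Iso (vcomp1m (idm x)) (vcomp1m (idm x)).

Definition id_linfunctor (k : fieldType) (X : lincat k) : linfunctor X X :=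
  @LinFunctor k X X (fun x => x) (fun x y a => a)
    (fun x y c a b => erefl) (fun x => erefl) (fun x y z b a => erefl).

Lemma comp_fmor_linear (k : fieldType) (X Y Z : lincat k)
    (G : linfunctor Y Z) (F : linfunctor X Y) (x y : X) :
  linear (fun a : mor x y => fmor G (fmor F a)).
Proof. by move=> c a b; rewrite !fmor_linear. Qed.

Lemma comp_fmor_id (k : fieldType) (X Y Z : lincat k)
    (G : linfunctor Y Z) (F : linfunctor X Y) (x : X) :
  fmor G (fmor F (idm x)) = idm (G (F x)).
Proof. by rewrite !fmor_id. Qed.

Lemma comp_fmor_comp (k : fieldType) (X Y Z : lincat k)
    (G : linfunctor Y Z) (F : linfunctor X Y) (x y z : X)
    (b : mor y z) (a : mor x y) :
  fmor G (fmor F (b \v a)) = fmor G (fmor F b) \v fmor G (fmor F a).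
Proof. by rewrite !fmor_comp. Qed.

Definition comp_linfunctor (k : fieldType) (X Y Z : lincat k)
    (G : linfunctor Y Z) (F : linfunctor X Y) : linfunctor X Z :=
  LinFunctor (comp_fmor_linear G F) (comp_fmor_id G F) (@comp_fmor_comp k X Y Z G F).

Record pseudofunctor (k : fieldType) (C D : bicat k) := PseudoFunctor {
  pf0 :> C -> D;
  pf1 : forall A B : C, linfunctor (Hom A B) (Hom (pf0 A) (pf0 B));
  pf_comp : forall (A B E : C) (g : Hom B E) (f : Hom A B),
    iso (pf1 B E g \c pf1 A B f) (pf1 A E (g \c f));
  pf_id : forall A : C, iso (id1 (pf0 A)) (pf1 A A (id1 A));
  pf_comp_nat : forall (A B E : C) (g g' : Hom B E) (f f' : Hom A B)
      (b : mor g g') (a : mor f f'),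
    fwd (pf_comp g' f') \v (fmor (pf1 B E) b \h fmor (pf1 A B) a)
      = fmor (pf1 A E) (b \h a) \v fwd (pf_comp g f);
  pf_assoc : forall (A B E E' : C) (h : Hom E E') (g : Hom B E) (f : Hom A B),
    fmor (pf1 A E') (fwd (assoc h g f)) \v fwd (pf_comp (h \c g) f)
      \v (fwd (pf_comp h g) \h idm (pf1 A B f))
    = fwd (pf_comp h (g \c f)) \v (idm (pf1 E E' h) \h fwd (pf_comp g f))
      \v fwd (assoc (pf1 E E' h) (pf1 B E g) (pf1 A B f));
  pf_lunit : forall (A B : C) (f : Hom A B),
    fmor (pf1 A B) (fwd (lunit f)) \v fwd (pf_comp (id1 B) f)
      \v (fwd (pf_id B) \h idm (pf1 A B f)) = fwd (lunit (pf1 A B f));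
  pf_runit : forall (A B : C) (f : Hom A B),
    fmor (pf1 A B) (fwd (runit f)) \v fwd (pf_comp f (id1 A))
      \v (idm (pf1 A B f) \h fwd (pf_id A)) = fwd (runit (pf1 A B f))
}.

Arguments pf1 {k C D} p {A B}.
Arguments pf_comp {k C D} p {A B E} g f.
Arguments pf_id {k C D} p A.

Lemma id_pf_comp_nat (k : fieldType) (C : bicat k) (A B E : C)
    (g g' : Hom B E) (f f' : Hom A B) (b : mor g g') (a : mor f f') :
  idm (g' \c f') \v (b \h a) = (b \h a) \v idm (g \c f).
Proof. by rewrite vcomp1m vcompm1. Qed.

Lemma id_pf_assoc (k : fieldType) (C : bicat k) (A B E E' : C)
    (h : Hom E E') (g : Hom B E) (f : Hom A B) :
  fwd (assoc h g f) \v idm (h \c g \c f) \v (idm (h \c g) \h idm f)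
  = idm (h \c (g \c f)) \v (idm h \h idm (g \c f)) \v fwd (assoc h g f).
Proof. by rewrite !comp2_id !vcompm1 !vcomp1m. Qed.

Lemma id_pf_lunit (k : fieldType) (C : bicat k) (A B : C) (f : Hom A B) :
  fwd (lunit f) \v idm (id1 B \c f) \v (idm (id1 B) \h idm f) = fwd (lunit f).
Proof. by rewrite comp2_id !vcompm1. Qed.

Lemma id_pf_runit (k : fieldType) (C : bicat k) (A B : C) (f : Hom A B) :
  fwd (runit f) \v idm (f \c id1 A) \v (idm f \h idm (id1 A)) = fwd (runit f).
Proof. by rewrite comp2_id !vcompm1. Qed.

Definition id_pf (k : fieldType) (C : bicat k) : pseudofunctor C C :=
  @PseudoFunctor k C C (fun A => A) (fun A B => id_linfunctor (Hom A B))
    (fun A B E g f => id_iso (g \c f)) (fun A => id_iso (id1 A))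
    (@id_pf_comp_nat k C) (@id_pf_assoc k C) (@id_pf_lunit k C) (@id_pf_runit k C).

Section CompositePseudofunctor.
Context (k : fieldType) (C D E : bicat k)
  (G : pseudofunctor D E) (F : pseudofunctor C D).

Let GF1 (A B : C) : linfunctor (Hom A B) (Hom (G (F A)) (G (F B))) :=
  comp_linfunctor (pf1 G) (pf1 F).

Let GFc (A B B' : C) (g : Hom B B') (f : Hom A B) :
    iso (GF1 B B' g \c GF1 A B f) (GF1 A B' (g \c f)) :=
  comp_iso (fmap_iso (pf1 G) (pf_comp F g f)) (pf_comp G (pf1 F g) (pf1 F f)).

Let GFi (A : C) : iso (id1 (G (F A))) (GF1 A A (id1 A)) :=
  comp_iso (fmap_iso (pf1 G) (pf_id F A)) (pf_id G (F A)).

Lemma comp_pf_comp_nat (A B B' : C) (g g' : Hom B B') (f f' : Hom A B)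
    (b : mor g g') (a : mor f f') :
  fwd (GFc g' f') \v (fmor (GF1 B B') b \h fmor (GF1 A B) a)
    = fmor (GF1 A B') (b \h a) \v fwd (GFc g f).
Proof.
by rewrite /= -vcompA pf_comp_nat !vcompA -!fmor_comp pf_comp_nat.
Qed.

Lemma comp_pf_assoc (A B B' B'' : C) (h : Hom B' B'') (g : Hom B B') (f : Hom A B) :
  fmor (GF1 A B'') (fwd (assoc h g f)) \v fwd (GFc (h \c g) f)
    \v (fwd (GFc h g) \h idm (GF1 A B f))
  = fwd (GFc h (g \c f)) \v (idm (GF1 B' B'' h) \h fwd (GFc g f))
    \v fwd (assoc (GF1 B' B'' h) (GF1 B B' g) (GF1 A B f)).
Proof.
rewrite /=.
have -> : idm (pf1 G (pf1 F f)) = fmor (pf1 G) (idm (pf1 F f)) \v idm (pf1 G (pf1 F f)).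
  by rewrite fmor_id vcomp1m.
have -> : idm (pf1 G (pf1 F h)) = fmor (pf1 G) (idm (pf1 F h)) \v idm (pf1 G (pf1 F h)).
  by rewrite fmor_id vcomp1m.
rewrite !interchange !vcompA.
rewrite -(vcompA _ (fwd (pf_comp G _ _)) (fmor _ _ \h fmor _ _)) pf_comp_nat.
rewrite -(vcompA _ (fwd (pf_comp G _ _)) (fmor _ _ \h fmor _ _)) pf_comp_nat.
by rewrite !vcompA -!fmor_comp pf_assoc 2!fmor_comp -!vcompA [fmor _ (fwd (assoc _ _ _)) \v _]vcompA pf_assoc !vcompA.
Qed.

Lemma comp_pf_lunit (A B : C) (f : Hom A B) :
  fmor (GF1 A B) (fwd (lunit f)) \v fwd (GFc (id1 B) f)
    \v (fwd (GFi B) \h idm (GF1 A B f)) = fwd (lunit (GF1 A B f)).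
Proof.
rewrite /=.
have -> : idm (pf1 G (pf1 F f)) = fmor (pf1 G) (idm (pf1 F f)) \v idm (pf1 G (pf1 F f)).
  by rewrite fmor_id vcomp1m.
rewrite interchange !vcompA.
rewrite -(vcompA _ (fwd (pf_comp G _ _)) (fmor _ _ \h fmor _ _)) pf_comp_nat.
by rewrite !vcompA -!fmor_comp pf_lunit pf_lunit.
Qed.

Lemma comp_pf_runit (A B : C) (f : Hom A B) :
  fmor (GF1 A B) (fwd (runit f)) \v fwd (GFc f (id1 A))
    \v (idm (GF1 A B f) \h fwd (GFi A)) = fwd (runit (GF1 A B f)).
Proof.
rewrite /=.
have -> : idm (pf1 G (pf1 F f)) = fmor (pf1 G) (idm (pf1 F f)) \v idm (pf1 G (pf1 F f)).
  by rewrite fmor_id vcomp1m.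
rewrite interchange !vcompA.
rewrite -(vcompA _ (fwd (pf_comp G _ _)) (fmor _ _ \h fmor _ _)) pf_comp_nat.
by rewrite !vcompA -!fmor_comp pf_runit pf_runit.
Qed.

Definition comp_pf : pseudofunctor C E :=
  @PseudoFunctor k C E (fun A => G (F A)) GF1 GFc GFi
    comp_pf_comp_nat comp_pf_assoc comp_pf_lunit comp_pf_runit.
End CompositePseudofunctor.

Record pseudonat (k : fieldType) (C D : bicat k) (F G : pseudofunctor C D) :=
    PseudoNat {
  pn0 : forall A : C, Hom (F A) (G A);
  pn1 : forall (A B : C) (f : Hom A B),
    iso (pf1 G f \c pn0 A) (pn0 B \c pf1 F f);
  pn1_nat : forall (A B : C) (f f' : Hom A B) (a : mor f f'),
    fwd (pn1 f') \v (fmor (pf1 G) a \h idm (pn0 A))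
      = (idm (pn0 B) \h fmor (pf1 F) a) \v fwd (pn1 f);
  pn1_id : forall A : C,
    fwd (pn1 (id1 A)) \v (fwd (pf_id G A) \h idm (pn0 A))
      = (idm (pn0 A) \h fwd (pf_id F A)) \v bwd (runit (pn0 A))
        \v fwd (lunit (pn0 A));
  pn1_comp : forall (A B E : C) (g : Hom B E) (f : Hom A B),
    fwd (pn1 (g \c f)) \v (fwd (pf_comp G g f) \h idm (pn0 A))
      = (idm (pn0 E) \h fwd (pf_comp F g f))
        \v fwd (assoc (pn0 E) (pf1 F g) (pf1 F f))
        \v (fwd (pn1 g) \h idm (pf1 F f))
        \v bwd (assoc (pf1 G g) (pn0 B) (pf1 F f))
        \v (idm (pf1 G g) \h fwd (pn1 f))
        \v fwd (assoc (pf1 G g) (pf1 G f) (pn0 A))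
}.

(* A pseudonatural equivalence is a pseudonatural transformation each of whose
   components is an equivalence. *)
Definition pseudonat_equivalent (k : fieldType) (C D : bicat k)
    (F G : pseudofunctor C D) : Prop :=
  exists t : pseudonat F G, forall A : C, equivalence1 (pn0 t A).

Definition linearly_equivalent (k : fieldType) (C D : bicat k) : Prop :=
  exists (F : pseudofunctor C D) (G : pseudofunctor D C),
    pseudonat_equivalent (comp_pf G F) (id_pf C) /\
    pseudonat_equivalent (comp_pf F G) (id_pf D).

(* Main.v *)
From mathcomp Require Import all_boot all_order all_algebra.
Require Import Defs.

Set Implicit Arguments.
Unset Strict Implicit.
Unset Printing Implicit Defensive.

Import GRing.Theory.
Local Open Scope ring_scope.

(** Two things separate a semisimple 2-category from a strict one in the sense
    of Douglas and Reutter: strictness, and the splitting of separable monads by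
    adjunctions instead of the splitting of condensation monads by condensations.

    Strictness is achieved by replacing 1-morphisms by formal composites: either
    a formal identity or a nonempty path of 1-morphisms. They compose by
    concatenation, which is strictly associative and unital, and each has a value
    in C; 2-morphisms between formal composites are those between the values.
    More generally, whenever 1-morphisms of C are presented by words with a
    composition that the values respect up to arbitrary chosen isomorphisms, the
    whole bicategory structure of C can be conjugated by these isomorphisms
    (transport). The axioms then hold automatically, by pasting squares, and
    taking values is an equivalence with C which is bijective on objects and on
    2-morphisms (transport_equivalent). For formal composites the isomorphisms
    are the canonical rebracketings, and the pentagon, the triangle and Kelly's
    unit identities say that the conjugated constraints are identities
    (transport_formal_strict).

    For idempotent completeness (has_condensates_idempotent_complete2), any
    bimodule section of the multiplication of a monad is coassociative, so a
    separable monad is a condensation monad and extends to a condensation f, g,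
    phi, gamma. The unit of the monad gives a candidate unit for an adjunction
    between f and g with counit phi. The unit laws of the monad are the two
    zigzag identities whiskered with g and with f, and since phi is a split
    epimorphism these whiskerings are faithful on the endomorphisms at hand.

    The remaining clauses are invariant under the passage from C to the
    transported bicategory, which names 1-morphisms differently but changes
    neither objects nor, up to isomorphism, composition. *)

(** * Linear categories *)

Section LinearCategory.
Context (k : fieldType) (X : lincat k).
Implicit Types x y z w : X.

Lemma bwd_fwdK x y z (t : iso x y) (a : mor z x) : bwd t \v (fwd t \v a) = a.
Proof. by rewrite vcompA fwdK vcomp1m. Qed.

Lemma fwd_bwdK x y z (t : iso x y) (a : mor z y) : fwd t \v (bwd t \v a) = a.
Proof. by rewrite vcompA bwdK vcomp1m. Qed.

Lemma vcompm_fwdK x y z (t : iso x y) (a : mor y z) : a \v fwd t \v bwd t = a.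
Proof. by rewrite -vcompA bwdK vcompm1. Qed.

Lemma vcompm_bwdK x y z (t : iso x y) (a : mor x z) : a \v bwd t \v fwd t = a.
Proof. by rewrite -vcompA fwdK vcompm1. Qed.

Lemma fwd_epi x y z (t : iso x y) (a b : mor y z) :
  a \v fwd t = b \v fwd t -> a = b.
Proof. by move=> eq_ab; rewrite -(vcompm_fwdK t a) eq_ab vcompm_fwdK. Qed.

Lemma fwd_mono x y z (t : iso x y) (a b : mor z x) :
  fwd t \v a = fwd t \v b -> a = b.
Proof. by move=> eq_ab; rewrite -(bwd_fwdK t a) eq_ab bwd_fwdK. Qed.

Lemma vcompDl x y z (a : mor x y) (b b' : mor y z) :
  (b + b') \v a = b \v a + b' \v a.
Proof. by have /= := vcomp_linear_l a 1 b b'; rewrite !scale1r. Qed.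

Lemma vcompDr x y z (b : mor y z) (a a' : mor x y) :
  b \v (a + a') = b \v a + b \v a'.
Proof. by have /= := vcomp_linear_r b 1 a a'; rewrite !scale1r. Qed.

Lemma vcomp0m x y z (a : mor x y) : (0 : mor y z) \v a = 0.
Proof. by apply: (addrI (0 \v a)); rewrite -vcompDl !addr0. Qed.

Lemma vcompm0 x y z (b : mor y z) : b \v (0 : mor x y) = 0.
Proof. by apply: (addrI (b \v 0)); rewrite -vcompDr !addr0. Qed.

Lemma vcomp_sum x y z w n (b : mor z w) (c : 'I_n -> mor y z) (a : mor x y) :
  b \v (\sum_i c i) \v a = \sum_i (b \v c i \v a).
Proof.
have add : {morph (fun c => b \v c \v a) : c c' / c + c'}.
  by move=> c1 c2; rewrite vcompDr vcompDl.
by rewrite (big_morph _ add (_ : _ = 0)) // vcompm0 vcomp0m.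
Qed.

(** Transported structure is characterised by the squares that it makes with the
    original one; its axioms follow by stacking such squares. *)
Lemma paste x1 x2 x3 y1 y2 y3 (p1 : mor x1 y1) (p2 : mor x2 y2)
    (p3 : mor x3 y3) (f : mor x1 x2) (f' : mor x2 x3)
    (g : mor y1 y2) (g' : mor y2 y3) :
  g \v p1 = p2 \v f -> g' \v p2 = p3 \v f' ->
  g' \v g \v p1 = p3 \v (f' \v f).
Proof. by move=> sq sq'; rewrite -vcompA sq vcompA sq' vcompA. Qed.

Definition inv_iso x y (t : iso x y) : iso y x := Iso (bwdK t) (fwdK t).

Definition eq_iso x y (e : x = y) : iso x y :=
  match e in _ = z return iso x z with erefl => id_iso x end.

Lemma is_zero_iso x y : iso x y -> is_zero x -> is_zero y.
Proof.
move=> t x0; rewrite /is_zero -(bwdK t) -[bwd t]vcomp1m x0.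
by rewrite vcomp0m vcompm0.
Qed.

Lemma is_dirsum_iso n (x x' : 'I_n -> X) (s s' : X) :
  (forall a, iso (x a) (x' a)) -> iso s s' -> is_dirsum x s -> is_dirsum x' s'.
Proof.
move=> u t [i [p [pi1 pi0 ip]]].
exists (fun a => fwd t \v i a \v bwd (u a)), (fun a => fwd (u a) \v p a \v bwd t).
split=> [a | a b neq_ab |].
- by rewrite -!vcompA bwd_fwdK [p a \v _]vcompA pi1 vcomp1m bwdK.
- by rewrite -!vcompA bwd_fwdK [p a \v _]vcompA pi0 // vcomp0m vcompm0.
rewrite -[RHS](bwdK t) -[fwd t in RHS]vcompm1 -ip vcomp_sum.
by apply: eq_bigr => a _; rewrite -!vcompA bwd_fwdK.
Qed.

Lemma simple_in_iso x y : iso x y -> simple_in x -> simple_in y.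
Proof.
move=> t [nz_x simple_x]; split=> [|z m mono_m].
  by move=> /(is_zero_iso (inv_iso t)).
have mono_tm : mono (bwd t \v m).
  move=> w a b; rewrite -!vcompA => /(@fwd_mono _ _ _ (inv_iso t)).
  exact: mono_m.
have [|[m' [m'K mK']]] := simple_x _ _ mono_tm; [by left | right].
exists (m' \v bwd t); split; first by rewrite -vcompA.
by rewrite -(vcompm_bwdK (inv_iso t) (m \v _)) /= -[RHS](bwdK t)
  -[fwd t in RHS]vcompm1 -mK' !vcompA bwdK vcomp1m vcompm_bwdK.
Qed.

End LinearCategory.

(** * Coherence in a bicategory *)

Section Coherence.
Context (k : fieldType) (C : bicat k).

Lemma comp2_fwdK (A B D : C) (g g' : Hom B D) (f f' : Hom A B)
    (t : iso g g') (s : iso f f') :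
  (bwd t \h bwd s) \v (fwd t \h fwd s) = idm (g \c f).
Proof. by rewrite -interchange !fwdK comp2_id. Qed.

Lemma comp2_bwdK (A B D : C) (g g' : Hom B D) (f f' : Hom A B)
    (t : iso g g') (s : iso f f') :
  (fwd t \h fwd s) \v (bwd t \h bwd s) = idm (g' \c f').
Proof. by rewrite -interchange !bwdK comp2_id. Qed.

Definition comp1_iso (A B D : C) (g g' : Hom B D) (f f' : Hom A B)
    (t : iso g g') (s : iso f f') : iso (g \c f) (g' \c f') :=
  Iso (comp2_fwdK t s) (comp2_bwdK t s).

Lemma whiskerr_vcomp (A B D : C) (g g' g'' : Hom B D) (f : Hom A B)
    (b' : mor g' g'') (b : mor g g') :
  (b' \v b) \h idm f = b' \h idm f \v b \h idm f.
Proof. by rewrite -interchange vcomp1m. Qed.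

Lemma whiskerl_vcomp (A B D : C) (g : Hom B D) (f f' f'' : Hom A B)
    (a' : mor f' f'') (a : mor f f') :
  idm g \h (a' \v a) = idm g \h a' \v idm g \h a.
Proof. by rewrite -interchange vcomp1m. Qed.

Lemma comp2_lr (A B D : C) (g g' : Hom B D) (f f' : Hom A B)
    (b : mor g g') (a : mor f f') :
  b \h a = b \h idm f' \v idm g \h a.
Proof. by rewrite -interchange vcomp1m vcompm1. Qed.

Lemma comp2_rl (A B D : C) (g g' : Hom B D) (f f' : Hom A B)
    (b : mor g g') (a : mor f f') :
  b \h a = idm g' \h a \v b \h idm f.
Proof. by rewrite -interchange vcomp1m vcompm1. Qed.

Lemma assocV_nat (A B D E : C) (h h' : Hom D E) (g g' : Hom B D)
    (f f' : Hom A B) (c : mor h h') (b : mor g g') (a : mor f f') :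
  bwd (assoc h' g' f') \v c \h (b \h a) = c \h b \h a \v bwd (assoc h g f).
Proof.
apply: (fwd_epi (t := assoc h g f)).
by rewrite vcompm_bwdK -vcompA -assoc_nat bwd_fwdK.
Qed.

Lemma lunitV_nat (A B : C) (f f' : Hom A B) (a : mor f f') :
  bwd (lunit f') \v a = idm (id1 B) \h a \v bwd (lunit f).
Proof.
apply: (fwd_epi (t := lunit f)).
by rewrite vcompm_bwdK -vcompA -lunit_nat bwd_fwdK.
Qed.

Lemma whisker_id1_inj (A B : C) (f f' : Hom A B) (a b : mor f f') :
  idm (id1 B) \h a = idm (id1 B) \h b -> a = b.
Proof.
move=> eq_ab; apply: (fwd_epi (t := lunit f)).
by rewrite -!lunit_nat eq_ab.
Qed.

Lemma id1_whisker_inj (A B : C) (f f' : Hom A B) (a b : mor f f') :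
  a \h idm (id1 A) = b \h idm (id1 A) -> a = b.
Proof.
move=> eq_ab; apply: (fwd_epi (t := runit f)).
by rewrite -!runit_nat eq_ab.
Qed.

(** Kelly's unit identities: the pentagon with two adjacent units and the
    triangle prove them after whiskering with a further unit, and such a
    whiskering is faithful. *)
Lemma lunit_comp1 (A B D : C) (g : Hom B D) (f : Hom A B) :
  fwd (lunit (g \c f)) \v fwd (assoc (id1 D) g f) = fwd (lunit g) \h idm f.
Proof.
apply: whisker_id1_inj.
apply: (fwd_epi (t := assoc (id1 D) (id1 D \c g) f)).
apply: (fwd_epi (t := comp1_iso (assoc (id1 D) (id1 D) g) (id_iso f))) => /=.
rewrite whiskerl_vcomp -!vcompA [X in _ \v X = _]vcompA -pentagon.
rewrite vcompA triangle -[idm (g \c f)]comp2_id -assoc_nat -triangle.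
by rewrite whiskerr_vcomp !vcompA assoc_nat.
Qed.

Lemma runit_comp1 (A B D : C) (g : Hom B D) (f : Hom A B) :
  idm g \h fwd (runit f) \v fwd (assoc g f (id1 A)) = fwd (runit (g \c f)).
Proof.
apply: id1_whisker_inj.
apply: (fwd_mono (t := assoc g f (id1 A))).
rewrite whiskerr_vcomp -(triangle (g \c f)) vcompA assoc_nat -(triangle f).
rewrite whiskerl_vcomp -!vcompA [X in _ \v X = _]vcompA -pentagon.
by rewrite !vcompA -assoc_nat comp2_id.
Qed.

(** By naturality the left constraint of a composite of two identities is the
    left constraint of one of them, whiskered; Kelly's identity and the triangle
    then compare the two constraints. *)
Lemma lunit_id1 (A : C) : fwd (lunit (id1 A)) = fwd (runit (id1 A)).
Proof.
apply: id1_whisker_inj; rewrite -triangle -lunit_comp1; congr (_ \v _).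
by apply: (fwd_mono (t := lunit (id1 A))); rewrite lunit_nat.
Qed.

End Coherence.

(** * Splitting separable monads *)

Section SeparableMonad.
Context (k : fieldType) (C : bicat k).

(** Both sides of coassociativity become, after precomposition with the split
    epimorphism m, the composite of d applied on both factors of p o p followed by
    the multiplication of the two middle factors: the two clauses of equivariance
    are applied in one order on one side and in the opposite order on the other. *)
Lemma bimodule_section_coassoc (A : C) (p : Hom A A)
    (m : mor (p \c p) p) (d : mor p (p \c p)) :
  bimodule_map m d -> m \v d = idm p -> coassociative_comul d.
Proof.
move=> [dmr dml] md1; rewrite /coassociative_comul.
have epi_m x (a b : mor p x) : a \v m = b \v m -> a = b.
  by move=> eq_ab; rewrite -(vcompm1 a) -md1 vcompA eq_ab -vcompA md1 vcompm1.
apply: epi_m.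
have -> : fwd (assoc p p p) \v d \h idm p \v d \v m
    = idm p \h (m \h idm p) \v fwd (assoc p (p \c p) p)
      \v fwd (assoc p p p) \h idm p \v bwd (assoc (p \c p) p p) \v d \h d.
  rewrite -!vcompA dmr -!vcompA.
  rewrite [d \h _ \v (_ \v _)]vcompA -whiskerr_vcomp dml !whiskerr_vcomp -!vcompA.
  rewrite [d \h _ \h _ \v (_ \v _)]vcompA -assocV_nat comp2_id -!vcompA.
  by rewrite -comp2_lr vcompA assoc_nat -!vcompA.
rewrite -!vcompA dml -!vcompA.
rewrite [idm p \h d \v (_ \v _)]vcompA -whiskerl_vcomp dmr !whiskerl_vcomp -!vcompA.
rewrite [idm p \h (_ \h d) \v _]vcompA -assoc_nat comp2_id -!vcompA -comp2_rl.
congr (_ \v _); apply: (fwd_mono (t := comp1_iso (id_iso p) (assoc p p p))) => /=.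
rewrite [RHS]vcompA -whiskerl_vcomp bwdK comp2_id vcomp1m.
by rewrite !vcompA -pentagon vcompm_fwdK.
Qed.

Section UnitalCondensation.
Context (A B : C) (f : Hom A B) (g : Hom B A).
Context (phi : mor (f \c g) (id1 B)) (gamma : mor (id1 B) (f \c g)).
Context (eta : mor (id1 A) (g \c f)).
Hypothesis phi_gamma : phi \v gamma = idm (id1 B).

(** If psi becomes trivial after composing with g, it becomes trivial after
    composing with f o g. By naturality, phi carries this trivial endomorphism of
    f o g o f to psi, and phi is a split epimorphism. *)
Lemma whiskerl_section_id (psi : mor f f) :
  idm g \h psi = idm (g \c f) -> psi = idm f.
Proof.
move=> g_psi; pose r := fwd (lunit f) \v phi \h idm f.
have fg_psi : idm (f \c g) \h psi = idm (f \c g \c f).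
  apply: (fwd_mono (t := assoc f g f)).
  by rewrite -comp2_id assoc_nat g_psi comp2_id vcomp1m vcompm1.
have psi_r : psi \v r = r.
  rewrite /r vcompA -lunit_nat -vcompA -comp2_rl comp2_lr fg_psi.
  by rewrite vcompm1.
have r_split : r \v (gamma \h idm f \v bwd (lunit f)) = idm f.
  rewrite /r -!vcompA [_ \h _ \v (_ \v _)]vcompA -whiskerr_vcomp phi_gamma.
  by rewrite comp2_id vcomp1m bwdK.
by rewrite -[LHS]vcompm1 -r_split vcompA psi_r.
Qed.

Lemma whiskerr_section_id (psi : mor g g) :
  psi \h idm f = idm (g \c f) -> psi = idm g.
Proof.
move=> psi_f; pose r := fwd (runit g) \v idm g \h phi.
have psi_fg : psi \h idm (f \c g) = idm (g \c (f \c g)).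
  apply: (fwd_epi (t := assoc g f g)).
  by rewrite -comp2_id -assoc_nat psi_f comp2_id vcomp1m vcompm1.
have psi_r : psi \v r = r.
  rewrite /r vcompA -runit_nat -vcompA -comp2_lr comp2_rl psi_fg.
  by rewrite vcompm1.
have r_split : r \v (idm g \h gamma \v bwd (runit g)) = idm g.
  rewrite /r -!vcompA [_ \h _ \v (_ \v _)]vcompA -whiskerl_vcomp phi_gamma.
  by rewrite comp2_id vcomp1m bwdK.
by rewrite -[LHS]vcompm1 -r_split vcompA psi_r.
Qed.

Hypothesis mul_unit_r :
  whisk_in phi \v idm (g \c f) \h eta = fwd (runit (g \c f)).
Hypothesis mul_unit_l :
  whisk_in phi \v eta \h idm (g \c f) = fwd (lunit (g \c f)).

(** Whiskered with g, this zigzag is multiplication in g o f by the unit on the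
    right. *)
Lemma condensation_zigzag_l :
  fwd (lunit f) \v (phi \h idm f) \v bwd (assoc f g f)
    \v (idm f \h eta) \v bwd (runit f) = idm f.
Proof.
apply: whiskerl_section_id.
apply: (fwd_epi (t := comp1_iso (id_iso g) (runit f))) => /=.
rewrite -whiskerl_vcomp vcompm_bwdK vcomp1m.
apply: (fwd_epi (t := assoc g f (id1 A))).
rewrite runit_comp1 -mul_unit_r /whisk_in /rebracket.
by rewrite -comp2_id -!vcompA assoc_nat !whiskerl_vcomp -!vcompA.
Qed.

(** Whiskered with f, this zigzag is multiplication in g o f by the unit on the
    left. *)
Lemma condensation_zigzag_r :
  fwd (runit g) \v (idm g \h phi) \v fwd (assoc g f g)
    \v (eta \h idm g) \v bwd (lunit g) = idm g.
Proof.
apply: whiskerr_section_id.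
apply: (fwd_epi (t := comp1_iso (lunit g) (id_iso f))) => /=.
rewrite -whiskerr_vcomp vcompm_bwdK vcomp1m -lunit_comp1 -mul_unit_l.
rewrite !whiskerr_vcomp -triangle /whisk_in /rebracket whiskerl_vcomp.
rewrite -!vcompA; congr (_ \v _).
rewrite !vcompA assoc_nat -!vcompA; congr (_ \v _).
rewrite -comp2_id -assoc_nat.
apply: (fwd_mono (t := comp1_iso (id_iso g) (assoc f g f))) => /=.
by rewrite !vcompA -pentagon -whiskerl_vcomp bwdK comp2_id vcomp1m.
Qed.

Definition condensation_adjunction : adjunction f g :=
  Adjunction condensation_zigzag_l condensation_zigzag_r.

End UnitalCondensation.

(** A separable monad is a condensation monad for any choice of section of its
    multiplication; the unit of the monad then turns a condensation extending
    it into an adjunction. *)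
Lemma has_condensates_idempotent_complete2 :
  has_condensates C -> idempotent_complete2 C.
Proof.
move=> [idemC condC]; split=> // A p m u [mA mul mur] [d [dm md]].
pose M := CondMonad mA (bimodule_section_coassoc dm md) dm md.
have [B [X [theta [/= m_eq _]]]] := condC M.
have theta_mul : fwd theta \v whisk_in (cd_phi X)
    = m \v (fwd theta \h fwd theta).
  by rewrite m_eq -!vcompA comp2_fwdK vcompm1.
pose eta := bwd theta \v u.
have theta_eta : fwd theta \v eta = u by rewrite fwd_bwdK.
have unit_r : whisk_in (cd_phi X) \v idm (cd_g X \c cd_f X) \h eta
    = fwd (runit (cd_g X \c cd_f X)).
  apply: (fwd_mono (t := theta)).
  rewrite vcompA theta_mul -vcompA -interchange theta_eta vcompm1.
  by rewrite comp2_rl vcompA mur runit_nat.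
have unit_l : whisk_in (cd_phi X) \v eta \h idm (cd_g X \c cd_f X)
    = fwd (lunit (cd_g X \c cd_f X)).
  apply: (fwd_mono (t := theta)).
  rewrite vcompA theta_mul -vcompA -interchange theta_eta vcompm1.
  by rewrite comp2_lr vcompA mul lunit_nat.
exists B, (cd_f X), (cd_g X).
exists (condensation_adjunction (cd_section X) unit_r unit_l).
split; first by exists (cd_gamma X); exact: cd_section.
by exists theta.
Qed.

End SeparableMonad.

(** * Categories of names *)

(** An object of X may have several names, and names of the same object are
    isomorphic; so X is replaced by an equivalent category as soon as every object
    has a name. *)
Definition naming (k : fieldType) (X : lincat k) (T : Type) (e : T -> X) :
    lincat k :=
  @LinCat k T (fun s t => mor (e s) (e t)) (fun t => idm (e t))
    (fun x y z b a => b \v a) (fun x y a => vcomp1m a) (fun x y a => vcompm1 a)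
    (fun x y z w c b a => vcompA c b a)
    (fun x y z a => vcomp_linear_l a) (fun x y z b => vcomp_linear_r b).

Section Naming.
Context (k : fieldType) (X : lincat k) (T : Type) (e : T -> X) (name : X -> T).
Hypothesis nameK : cancel name e.

Local Notation N := (naming e).

Definition naming_iso (s t : T) (u : iso (e s) (e t)) : iso (X := N) s t :=
  @Iso k N s t (fwd u) (bwd u) (fwdK u) (bwdK u).

Lemma naming_mono (s t : N) (m : mor s t) : mono m -> mono (X := X) m.
Proof. by move=> mono_m z; rewrite -(nameK z); apply: mono_m. Qed.

Lemma naming_epi (s t : N) (m : mor s t) : epi m -> epi (X := X) m.
Proof. by move=> epi_m z; rewrite -(nameK z); apply: epi_m. Qed.

Lemma naming_additive : additive_cat X -> additive_cat N.
Proof.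
move=> addX n x; have [s] := addX n (e \o x).
by rewrite -(nameK s) => sum_s; exists (name s).
Qed.

Lemma naming_idempotent_complete :
  idempotent_complete_cat X -> idempotent_complete_cat N.
Proof.
move=> splitX x p pp; have [y] := splitX _ _ pp.
by rewrite -(nameK y) => split_y; exists (name y).
Qed.

Lemma naming_abelian : abelian_cat X -> abelian_cat N.
Proof.
move=> [addX [kerX cokX monoX epiX]].
split; first exact: naming_additive; split=> [x y f|x y f|z x m|y z q].
- have [z] := kerX _ _ f; rewrite -(nameK z) => -[m [fm0 m_univ]].
  by exists (name z), m; split=> // w; apply: m_univ.
- have [z] := cokX _ _ f; rewrite -(nameK z) => -[q [qf0 q_univ]].
  by exists (name z), q; split=> // w; apply: q_univ.
- move/naming_mono => /monoX [y]; rewrite -(nameK y) => -[f [fm0 m_univ]].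
  by exists (name y), f; split=> // w; apply: m_univ.
move/naming_epi => /epiX [x]; rewrite -(nameK x) => -[f [qf0 q_univ]].
by exists (name x), f; split=> // w; apply: q_univ.
Qed.

Lemma naming_simple (t : N) : simple_in (X := X) (e t) <-> simple_in t.
Proof.
split=> -[nz simple_t]; split=> // y m.
  by move/naming_mono; apply: simple_t.
move: m; rewrite -(nameK y) => m mono_m.
by apply: (simple_t (name y) m) => z; apply: mono_m.
Qed.

Lemma naming_semisimple : semisimple_cat X -> semisimple_cat N.
Proof.
move=> [abX decX]; split=> [|x]; first exact: naming_abelian.
have [n [s [simple_s sum_s]]] := decX (e x).
have s_name a : iso (s a) (e (name (s a))) := eq_iso (esym (nameK (s a))).
exists n, (name \o s); split=> [a|].
  exact/naming_simple/(simple_in_iso (s_name a)).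
exact: (is_dirsum_iso s_name (id_iso (e x)) sum_s).
Qed.

Lemma naming_finite_semisimple :
  finite_semisimple_cat X -> finite_semisimple_cat N.
Proof.
move=> [ssX finX [n [S simpleS]]]; split=> [|x y|].
- exact: naming_semisimple.
- exact: finX.
exists n, (name \o S) => x /naming_simple /simpleS [i [t]]; exists i.
constructor; apply: naming_iso.
exact: comp_iso (eq_iso (esym (nameK (S i)))) t.
Qed.

End Naming.

(** * Transport of a bicategory along a presentation *)

(** The isomorphisms value_id and value_comp are arbitrary, since they only serve
    to conjugate the constraints of C. Every 1-morphism equals, and is not just
    isomorphic to, the value of a word, so that a 1-morphism of C can be replaced
    by a value without transporting data along isomorphisms. *)
Record presentation (k : fieldType) (C : bicat k) := Presentation {
  word : C -> C -> Type;
  value : forall A B, word A B -> Hom A B;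
  name : forall A B, Hom A B -> word A B;
  nameK : forall A B, cancel (@name A B) (@value A B);
  wid : forall A, word A A;
  wcomp : forall A B D, word B D -> word A B -> word A D;
  value_id : forall A, iso (id1 A) (value (wid A));
  value_comp : forall A B D (q : word B D) (p : word A B),
    iso (value q \c value p) (value (wcomp q p))
}.

Section Transport.
Context (k : fieldType) (C : bicat k) (P : presentation C).

Local Notation W := (word P).
Local Notation "# w" := (value w) (at level 2, w at level 1, format "# w").
Local Notation "q ** p" := (wcomp q p) (at level 40, left associativity).
Local Notation phi := value_comp.

Definition tcomp2 (A B D : C) (g g' : W B D) (f f' : W A B)
    (b : mor #g #g') (a : mor #f #f') :
    mor #(g ** f) #(g' ** f') :=
  fwd (phi g' f') \v b \h a \v bwd (phi g f).

Definition value_comp3l (A B D E : C) (h : W D E) (g : W B D) (f : W A B) :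
    iso (#h \c #g \c #f) #(h ** g ** f) :=
  comp_iso (phi (h ** g) f) (comp1_iso (phi h g) (id_iso #f)).

Definition value_comp3r (A B D E : C) (h : W D E) (g : W B D) (f : W A B) :
    iso (#h \c (#g \c #f)) #(h ** (g ** f)) :=
  comp_iso (phi h (g ** f)) (comp1_iso (id_iso #h) (phi g f)).

Definition value_id1l (A B : C) (f : W A B) :
    iso (id1 B \c #f) #(wid P B ** f) :=
  comp_iso (phi (wid P B) f) (comp1_iso (value_id P B) (id_iso #f)).

Definition value_id1r (A B : C) (f : W A B) :
    iso (#f \c id1 A) #(f ** wid P A) :=
  comp_iso (phi f (wid P A)) (comp1_iso (id_iso #f) (value_id P A)).

Definition tassoc (A B D E : C) (h : W D E) (g : W B D) (f : W A B) :
    iso #(h ** g ** f) #(h ** (g ** f)) :=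
  comp_iso (value_comp3r h g f)
    (comp_iso (assoc #h #g #f) (inv_iso (value_comp3l h g f))).

Definition tlunit (A B : C) (f : W A B) : iso #(wid P B ** f) #f :=
  comp_iso (lunit #f) (inv_iso (value_id1l f)).

Definition trunit (A B : C) (f : W A B) : iso #(f ** wid P A) #f :=
  comp_iso (runit #f) (inv_iso (value_id1r f)).

Lemma tcomp2E (A B D : C) (g g' : W B D) (f f' : W A B)
    (b : mor #g #g') (a : mor #f #f') :
  tcomp2 b a \v fwd (phi g f) = fwd (phi g' f') \v b \h a.
Proof. exact: vcompm_bwdK. Qed.

Lemma tcomp2_square (A B D : C) (g g' : W B D) (f f' : W A B)
    (x x' : Hom B D) (y y' : Hom A B)
    (b : mor #g #g') (a : mor #f #f')
    (p : mor x #g) (p' : mor x' #g') (q : mor y #f) (q' : mor y' #f')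
    (b0 : mor x x') (a0 : mor y y') :
  b \v p = p' \v b0 -> a \v q = q' \v a0 ->
  tcomp2 b a \v (fwd (phi g f) \v p \h q)
    = fwd (phi g' f') \v p' \h q' \v b0 \h a0.
Proof.
move=> sqb sqa.
by rewrite vcompA tcomp2E -!vcompA -!interchange sqb sqa.
Qed.

Lemma tassocE (A B D E : C) (h : W D E) (g : W B D) (f : W A B) :
  fwd (tassoc h g f) \v fwd (value_comp3l h g f)
    = fwd (value_comp3r h g f) \v fwd (assoc #h #g #f).
Proof.
rewrite -[fwd (tassoc h g f)]/(fwd (value_comp3r h g f)
  \v (fwd (assoc #h #g #f) \v bwd (value_comp3l h g f))).
by rewrite vcompA vcompm_bwdK.
Qed.

Lemma tlunitE (A B : C) (f : W A B) :
  fwd (tlunit f) \v fwd (value_id1l f) = fwd (lunit #f).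
Proof. exact: vcompm_bwdK. Qed.

Lemma trunitE (A B : C) (f : W A B) :
  fwd (trunit f) \v fwd (value_id1r f) = fwd (runit #f).
Proof. exact: vcompm_bwdK. Qed.

Lemma tcomp2_linear_l (A B D : C) (g g' : W B D) (f f' : W A B)
    (a : mor #f #f') :
  linear (fun b : mor #g #g' => tcomp2 b a).
Proof.
by move=> c b b'; rewrite /tcomp2 comp2_linear_l vcomp_linear_r vcomp_linear_l.
Qed.

Lemma tcomp2_linear_r (A B D : C) (g g' : W B D) (f f' : W A B)
    (b : mor #g #g') :
  linear (fun a : mor #f #f' => tcomp2 b a).
Proof.
by move=> c a a'; rewrite /tcomp2 comp2_linear_r vcomp_linear_r vcomp_linear_l.
Qed.

Lemma tcomp2_id (A B D : C) (g : W B D) (f : W A B) :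
  tcomp2 (idm #g) (idm #f) = idm #(g ** f).
Proof. by rewrite /tcomp2 comp2_id vcompm1 bwdK. Qed.

Lemma tinterchange (A B D : C) (g g' g'' : W B D) (f f' f'' : W A B)
    (b' : mor #g' #g'') (b : mor #g #g')
    (a' : mor #f' #f'') (a : mor #f #f') :
  tcomp2 (b' \v b) (a' \v a) = tcomp2 b' a' \v tcomp2 b a.
Proof. by rewrite /tcomp2 !vcompA vcompm_bwdK interchange !vcompA. Qed.

Lemma tcomp2_3l (A B D E : C) (h h' : W D E) (g g' : W B D) (f f' : W A B)
    (c : mor #h #h') (b : mor #g #g') (a : mor #f #f') :
  tcomp2 (tcomp2 c b) a \v fwd (value_comp3l h g f)
    = fwd (value_comp3l h' g' f') \v c \h b \h a.
Proof.
by rewrite /= vcompA tcomp2E -!vcompA -!interchange tcomp2E vcomp1m vcompm1.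
Qed.

Lemma tcomp2_3r (A B D E : C) (h h' : W D E) (g g' : W B D) (f f' : W A B)
    (c : mor #h #h') (b : mor #g #g') (a : mor #f #f') :
  tcomp2 c (tcomp2 b a) \v fwd (value_comp3r h g f)
    = fwd (value_comp3r h' g' f') \v c \h (b \h a).
Proof.
by rewrite /= vcompA tcomp2E -!vcompA -!interchange tcomp2E vcomp1m vcompm1.
Qed.

Lemma tassoc_nat (A B D E : C) (h h' : W D E) (g g' : W B D) (f f' : W A B)
    (c : mor #h #h') (b : mor #g #g') (a : mor #f #f') :
  fwd (tassoc h' g' f') \v tcomp2 (tcomp2 c b) a
    = tcomp2 c (tcomp2 b a) \v fwd (tassoc h g f).
Proof.
apply: (fwd_epi (t := value_comp3l h g f)).
rewrite (paste (tcomp2_3l c b a) (tassocE h' g' f')).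
by rewrite (paste (tassocE h g f) (tcomp2_3r c b a)) assoc_nat.
Qed.

Lemma tcomp2_1l (A B : C) (f f' : W A B) (a : mor #f #f') :
  tcomp2 (idm #(wid P B)) a \v fwd (value_id1l f)
    = fwd (value_id1l f') \v idm (id1 B) \h a.
Proof.
by rewrite /= vcompA tcomp2E -!vcompA -!interchange !vcomp1m !vcompm1.
Qed.

Lemma tcomp2_1r (A B : C) (f f' : W A B) (a : mor #f #f') :
  tcomp2 a (idm #(wid P A)) \v fwd (value_id1r f)
    = fwd (value_id1r f') \v a \h idm (id1 A).
Proof.
by rewrite /= vcompA tcomp2E -!vcompA -!interchange !vcomp1m !vcompm1.
Qed.

Lemma tlunit_nat (A B : C) (f f' : W A B) (a : mor #f #f') :
  fwd (tlunit f') \v tcomp2 (idm #(wid P B)) a = a \v fwd (tlunit f).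
Proof.
apply: (fwd_epi (t := value_id1l f)).
rewrite -vcompA tcomp2_1l vcompA tlunitE.
by rewrite -[RHS]vcompA tlunitE lunit_nat.
Qed.

Lemma trunit_nat (A B : C) (f f' : W A B) (a : mor #f #f') :
  fwd (trunit f') \v tcomp2 a (idm #(wid P A)) = a \v fwd (trunit f).
Proof.
apply: (fwd_epi (t := value_id1r f)).
rewrite -vcompA tcomp2_1r vcompA trunitE.
by rewrite -[RHS]vcompA trunitE runit_nat.
Qed.

Lemma tassoc_2_2 (A B D E E' : C) (l : W E E') (h : W D E) (g : W B D)
    (f : W A B) :
  fwd (tassoc l h (g ** f))
    \v (fwd (phi (l ** h) (g ** f)) \v fwd (phi l h) \h fwd (phi g f))
  = fwd (phi l (h ** (g ** f))) \v idm #l \h fwd (value_comp3r h g f)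
    \v fwd (assoc #l #h (#g \c #f)).
Proof.
have -> : fwd (phi (l ** h) (g ** f)) \v fwd (phi l h) \h fwd (phi g f)
    = fwd (value_comp3l l h (g ** f)) \v idm _ \h idm _ \h fwd (phi g f).
  by rewrite /= comp2_id -vcompA -comp2_lr.
rewrite vcompA tassocE -vcompA assoc_nat vcompA /=.
by rewrite whiskerl_vcomp !vcompA.
Qed.

(** Each of the five edges of the pentagon of words is compared with the
    corresponding edge of the pentagon of values by a commuting square. *)
Lemma tpentagon (A B D E E' : C) (l : W E E') (h : W D E) (g : W B D)
    (f : W A B) :
  fwd (tassoc l h (g ** f)) \v fwd (tassoc (l ** h) g f)
    = tcomp2 (idm #l) (fwd (tassoc h g f)) \v fwd (tassoc l (h ** g) f)
        \v tcomp2 (fwd (tassoc l h g)) (idm #f).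
Proof.
pose t1 := comp_iso (phi (l ** h ** g) f)
  (comp1_iso (value_comp3l l h g) (id_iso #f)).
pose t2 := comp_iso (phi (l ** h) (g ** f)) (comp1_iso (phi l h) (phi g f)).
pose t3 := comp_iso (phi l (h ** (g ** f)))
  (comp1_iso (id_iso #l) (value_comp3r h g f)).
pose t4 := comp_iso (phi (l ** (h ** g)) f)
  (comp1_iso (value_comp3r l h g) (id_iso #f)).
pose t5 := comp_iso (phi l (h ** g ** f))
  (comp1_iso (id_iso #l) (value_comp3l h g f)).
have sq12 : fwd (tassoc (l ** h) g f) \v fwd t1
    = fwd t2 \v fwd (assoc (#l \c #h) #g #f).
  have -> : fwd t1
      = fwd (value_comp3l (l ** h) g f) \v fwd (phi l h) \h idm _ \h idm _.
    by rewrite /= whiskerr_vcomp !vcompA.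
  rewrite vcompA tassocE -vcompA assoc_nat comp2_id vcompA /=.
  by rewrite -(vcompA _ _ (fwd (phi l h) \h _)) -comp2_rl.
have sq23 : fwd (tassoc l h (g ** f)) \v fwd t2
    = fwd t3 \v fwd (assoc #l #h (#g \c #f)).
  exact: tassoc_2_2.
have sq14 : tcomp2 (fwd (tassoc l h g)) (idm #f) \v fwd t1
    = fwd t4 \v fwd (assoc #l #h #g) \h idm _.
  have -> : fwd t1 = fwd (phi _ f) \v fwd (value_comp3l l h g) \h idm _ by [].
  rewrite vcompA tcomp2E -vcompA -whiskerr_vcomp tassocE.
  by rewrite whiskerr_vcomp vcompA.
have sq45 : fwd (tassoc l (h ** g) f) \v fwd t4
    = fwd t5 \v fwd (assoc #l (#h \c #g) #f).
  have -> : fwd t4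
      = fwd (value_comp3l l (h ** g) f) \v idm _ \h fwd (phi h g) \h idm _.
    by rewrite /= whiskerr_vcomp !vcompA.
  rewrite vcompA tassocE -vcompA assoc_nat vcompA /=.
  by rewrite whiskerl_vcomp !vcompA.
have sq53 : tcomp2 (idm #l) (fwd (tassoc h g f)) \v fwd t5
    = fwd t3 \v idm _ \h fwd (assoc #h #g #f).
  have -> : fwd t5 = fwd (phi l _) \v idm _ \h fwd (value_comp3l h g f) by [].
  rewrite vcompA tcomp2E -vcompA -whiskerl_vcomp tassocE.
  by rewrite whiskerl_vcomp vcompA.
apply: (fwd_epi (t := t1)).
by rewrite (paste sq12 sq23) (paste sq14 (paste sq45 sq53)) pentagon.
Qed.

Lemma ttriangle (A B D : C) (g : W B D) (f : W A B) :
  tcomp2 (idm #g) (fwd (tlunit f)) \v fwd (tassoc g (wid P B) f)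
    = tcomp2 (fwd (trunit g)) (idm #f).
Proof.
pose t1 := comp_iso (phi (g ** wid P B) f)
  (comp1_iso (value_id1r g) (id_iso #f)).
pose t2 := comp_iso (phi g (wid P B ** f))
  (comp1_iso (id_iso #g) (value_id1l f)).
have sq12 : fwd (tassoc g (wid P B) f) \v fwd t1
    = fwd t2 \v fwd (assoc #g (id1 B) #f).
  have -> : fwd t1 = fwd (value_comp3l g (wid P B) f)
      \v idm _ \h fwd (value_id P B) \h idm _.
    by rewrite /= whiskerr_vcomp !vcompA.
  rewrite vcompA tassocE -vcompA assoc_nat vcompA /=.
  by rewrite whiskerl_vcomp !vcompA.
apply: (fwd_epi (t := t1)); rewrite -vcompA sq12 vcompA.
have -> : tcomp2 (idm #g) (fwd (tlunit f)) \v fwd t2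
    = fwd (phi g f) \v idm _ \h fwd (lunit #f).
  have -> : fwd t2 = fwd (phi g _) \v idm _ \h fwd (value_id1l f) by [].
  by rewrite vcompA tcomp2E -vcompA -whiskerl_vcomp tlunitE.
have -> : fwd t1 = fwd (phi _ f) \v fwd (value_id1r g) \h idm _ by [].
rewrite vcompA tcomp2E -[RHS]vcompA -whiskerr_vcomp trunitE.
by rewrite -vcompA triangle.
Qed.

Definition transport : bicat k :=
  @Bicat k C (fun A B => naming (@value k C P A B)) (wid P) (@wcomp k C P)
    tcomp2 tcomp2_linear_l tcomp2_linear_r tcomp2_id tinterchange
    (fun A B D E h g f => naming_iso (tassoc h g f))
    (fun A B f => naming_iso (tlunit f)) (fun A B f => naming_iso (trunit f))
    tassoc_nat tlunit_nat trunit_nat tpentagon ttriangle.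

End Transport.

(** * Pseudofunctors that are the identity on objects *)

Section Icon.
Context (k : fieldType) (C : bicat k).
Context (F1 : forall A B : C, linfunctor (Hom A B) (Hom A B)).
Context (Fc : forall (A B D : C) (g : Hom B D) (f : Hom A B),
  iso (F1 B D g \c F1 A B f) (F1 A D (g \c f))).
Context (Fi : forall A : C, iso (id1 A) (F1 A A (id1 A))).
Context (t : forall (A B : C) (f : Hom A B), iso f (F1 A B f)).

Hypothesis t_nat : forall (A B : C) (f f' : Hom A B) (a : mor f f'),
  fwd (t f') \v a = fmor (F1 A B) a \v fwd (t f).
Hypothesis t_comp : forall (A B D : C) (g : Hom B D) (f : Hom A B),
  fwd (t (g \c f)) = fwd (Fc g f) \v fwd (t g) \h fwd (t f).
Hypothesis t_id : forall A : C, fwd (t (id1 A)) = fwd (Fi A).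

(** The components of the transformation on objects are identities, so that
    only unit constraints intervene between t and its naturality squares. *)
Definition icon1 (A B : C) (f : Hom A B) :
    iso (f \c id1 A) (id1 B \c F1 A B f) :=
  comp_iso (inv_iso (lunit (F1 A B f))) (comp_iso (t f) (runit f)).

Lemma icon1_nat (A B : C) (f f' : Hom A B) (a : mor f f') :
  fwd (icon1 f') \v (a \h idm (id1 A))
    = (idm (id1 B) \h fmor (F1 A B) a) \v fwd (icon1 f).
Proof.
rewrite /= -!vcompA runit_nat [fwd (t f') \v _]vcompA t_nat.
by rewrite [RHS]vcompA -lunitV_nat -!vcompA.
Qed.

Lemma icon1_id (A : C) :
  fwd (icon1 (id1 A)) \v (idm (id1 A) \h idm (id1 A))
    = (idm (id1 A) \h fwd (Fi A)) \v bwd (runit (id1 A)) \v fwd (lunit (id1 A)).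
Proof.
rewrite comp2_id vcompm1 /= t_id vcompA lunitV_nat.
by rewrite lunit_id1 -!vcompA fwdK -lunit_id1 fwdK.
Qed.

(** The two middle unit constraints cancel by the triangle; the outer ones
    combine into those of the composite by Kelly's identities. *)
Lemma icon1_comp (A B D : C) (g : Hom B D) (f : Hom A B) :
  fwd (icon1 (g \c f)) \v (idm (g \c f) \h idm (id1 A))
    = (idm (id1 D) \h fwd (Fc g f))
      \v fwd (assoc (id1 D) (F1 B D g) (F1 A B f))
      \v (fwd (icon1 g) \h idm (F1 A B f))
      \v bwd (assoc g (id1 B) (F1 A B f))
      \v (idm g \h fwd (icon1 f))
      \v fwd (assoc g f (id1 A)).
Proof.
rewrite comp2_id vcompm1 /= t_comp !whiskerr_vcomp !whiskerl_vcomp.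
have lunitV_comp1 : fwd (assoc (id1 D) (F1 B D g) (F1 A B f))
    \v bwd (lunit (F1 B D g)) \h idm (F1 A B f)
  = bwd (lunit (F1 B D g \c F1 A B f)).
  apply: (fwd_mono (t := lunit (F1 B D g \c F1 A B f))).
  by rewrite bwdK vcompA lunit_comp1 -whiskerr_vcomp bwdK comp2_id.
have triangleV : fwd (runit g) \h idm (F1 A B f)
    \v (bwd (assoc g (id1 B) (F1 A B f)) \v idm g \h bwd (lunit (F1 A B f)))
  = idm (g \c F1 A B f).
  rewrite -triangle -!vcompA fwd_bwdK.
  by rewrite -whiskerl_vcomp bwdK comp2_id.
rewrite -!vcompA runit_comp1 [in RHS](vcompA _ (bwd (lunit _) \h _)) lunitV_comp1.
rewrite [in RHS](vcompA _ _ (idm g \h fwd (t f) \v _)).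
rewrite [in RHS](vcompA (fwd (runit g) \h _)) triangleV vcomp1m.
rewrite [in RHS](vcompA _ _ (fwd (runit _))) -comp2_lr.
by rewrite [in RHS]vcompA -lunitV_nat -!vcompA.
Qed.

Lemma id1_equivalence (A : C) : equivalence1 (id1 A).
Proof. by exists (id1 A); split; constructor; exact: lunit. Qed.

Lemma icon_equivalent_id F_nat F_assoc F_lunit F_runit :
  pseudonat_equivalent
    (@PseudoFunctor k C C (fun A => A) F1 Fc Fi F_nat F_assoc F_lunit F_runit)
    (id_pf C).
Proof.
exists (@PseudoNat k C C
  (@PseudoFunctor k C C (fun A => A) F1 Fc Fi F_nat F_assoc F_lunit F_runit)
  (id_pf C) (fun A => id1 A) icon1 icon1_nat icon1_id icon1_comp) => A.
exact: id1_equivalence.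
Qed.

End Icon.

(** * The transported bicategory is equivalent to the original one *)

Section TransportEquivalence.
Context (k : fieldType) (C : bicat k) (P : presentation C).

Local Notation D := (transport P).
Local Notation W := (word P).
Local Notation "# w" := (value w) (at level 2, w at level 1, format "# w").
Local Notation "q ** p" := (wcomp q p) (at level 40, left associativity).
Local Notation phi := value_comp.
Local Notation nm := (name P).

Definition value_functor (A B : C) : linfunctor (@Hom k D A B) (@Hom k C A B) :=
  @LinFunctor k (@Hom k D A B) (@Hom k C A B) (@value k C P A B)
    (fun x y a => a) (fun x y c a b => erefl) (fun x => erefl)
    (fun x y z b a => erefl).

Lemma value_assoc (A B E E' : C) (h : W E E') (g : W B E) (f : W A B) :
  fwd (tassoc h g f) \v fwd (phi (h ** g) f) \v (fwd (phi h g) \h idm #f)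
  = fwd (phi h (g ** f)) \v (idm #h \h fwd (phi g f))
    \v fwd (assoc #h #g #f).
Proof. by rewrite -vcompA; exact: tassocE. Qed.

Lemma value_lunit (A B : C) (f : W A B) :
  fwd (tlunit f) \v fwd (phi (wid P B) f) \v (fwd (value_id P B) \h idm #f)
  = fwd (lunit #f).
Proof. by rewrite -vcompA; exact: tlunitE. Qed.

Lemma value_runit (A B : C) (f : W A B) :
  fwd (trunit f) \v fwd (phi f (wid P A)) \v (idm #f \h fwd (value_id P A))
  = fwd (runit #f).
Proof. by rewrite -vcompA; exact: trunitE. Qed.

(** The squares that define the transported constraints are exactly the
    coherence conditions of this pseudofunctor. *)
Definition value_pf : pseudofunctor D C :=
  @PseudoFunctor k D C (fun A => A) value_functor
    (fun A B E g f => phi g f) (fun A => value_id P A)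
    (fun A B E g g' f f' b a => esym (tcomp2E b a))
    value_assoc value_lunit value_runit.

Definition value_name (A B : C) (f : Hom A B) : iso #(nm f) f :=
  eq_iso (nameK P f).

Definition name_mor (A B : C) (f f' : Hom A B) (a : mor f f') :
    mor #(nm f) #(nm f') :=
  bwd (value_name f') \v a \v fwd (value_name f).

Lemma name_morE (A B : C) (f f' : Hom A B) (a : mor f f') :
  name_mor a \v bwd (value_name f) = bwd (value_name f') \v a.
Proof. exact: vcompm_fwdK. Qed.

Lemma name_mor_linear (A B : C) (f f' : Hom A B) : linear (@name_mor A B f f').
Proof.
by move=> c a b; rewrite /name_mor vcomp_linear_r vcomp_linear_l.
Qed.

Lemma name_mor_id (A B : C) (f : Hom A B) : name_mor (idm f) = idm #(nm f).
Proof. by rewrite /name_mor vcompm1 fwdK. Qed.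

Lemma name_mor_comp (A B : C) (f f' f'' : Hom A B) (b : mor f' f'')
    (a : mor f f') :
  name_mor (b \v a) = name_mor b \v name_mor a.
Proof. by rewrite /name_mor !vcompA vcompm_fwdK. Qed.

Definition name_functor (A B : C) : linfunctor (@Hom k C A B) (@Hom k D A B) :=
  @LinFunctor k (@Hom k C A B) (@Hom k D A B) (@name k C P A B)
    (@name_mor A B) (@name_mor_linear A B) (@name_mor_id A B)
    (@name_mor_comp A B).

Definition value_comp_name (A B E : C) (g : Hom B E) (f : Hom A B) :
    iso (g \c f) #(nm g ** nm f) :=
  comp_iso (phi (nm g) (nm f))
    (comp1_iso (inv_iso (value_name g)) (inv_iso (value_name f))).

Definition name_comp (A B E : C) (g : Hom B E) (f : Hom A B) :
    iso #(nm g ** nm f) #(nm (g \c f)) :=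
  comp_iso (inv_iso (value_name (g \c f))) (inv_iso (value_comp_name g f)).

Definition name_id (A : C) : iso #(wid P A) #(nm (id1 A)) :=
  comp_iso (inv_iso (value_name (id1 A))) (inv_iso (value_id P A)).

Lemma name_compE (A B E : C) (g : Hom B E) (f : Hom A B) :
  fwd (name_comp g f) \v fwd (value_comp_name g f) = bwd (value_name (g \c f)).
Proof. exact: vcompm_bwdK. Qed.

Lemma name_idE (A : C) :
  fwd (name_id A) \v fwd (value_id P A) = bwd (value_name (id1 A)).
Proof. exact: vcompm_bwdK. Qed.

Lemma name_comp_nat (A B E : C) (g g' : Hom B E) (f f' : Hom A B)
    (b : mor g g') (a : mor f f') :
  fwd (name_comp g' f') \v tcomp2 (name_mor b) (name_mor a)
    = name_mor (b \h a) \v fwd (name_comp g f).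
Proof.
apply: (fwd_epi (t := value_comp_name g f)).
have sq : tcomp2 (name_mor b) (name_mor a) \v fwd (value_comp_name g f)
    = fwd (value_comp_name g' f') \v b \h a.
  by rewrite /= vcompA tcomp2E -!vcompA -!interchange !name_morE.
rewrite -vcompA sq vcompA name_compE.
by rewrite -[RHS]vcompA name_compE name_morE.
Qed.

Lemma name_assoc (A B E E' : C) (h : Hom E E') (g : Hom B E) (f : Hom A B) :
  name_mor (fwd (assoc h g f)) \v fwd (name_comp (h \c g) f)
    \v tcomp2 (fwd (name_comp h g)) (idm #(nm f))
  = fwd (name_comp h (g \c f)) \v tcomp2 (idm #(nm h)) (fwd (name_comp g f))
    \v fwd (tassoc (nm h) (nm g) (nm f)).
Proof.
pose n (X Y : C) (x : Hom X Y) := inv_iso (value_name x).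
pose t1 := comp_iso (value_comp3l (nm h) (nm g) (nm f))
  (comp1_iso (comp1_iso (n _ _ h) (n _ _ g)) (n _ _ f)).
pose t2 := comp_iso (value_comp3r (nm h) (nm g) (nm f))
  (comp1_iso (n _ _ h) (comp1_iso (n _ _ g) (n _ _ f))).
have sq12 : fwd (tassoc (nm h) (nm g) (nm f)) \v fwd t1
    = fwd t2 \v fwd (assoc h g f).
  have -> : fwd t1 = fwd (value_comp3l (nm h) (nm g) (nm f))
    \v fwd (n _ _ h) \h fwd (n _ _ g) \h fwd (n _ _ f) by [].
  by rewrite vcompA tassocE -vcompA assoc_nat vcompA.
have t1E : tcomp2 (fwd (name_comp h g)) (idm #(nm f)) \v fwd t1
    = fwd (value_comp_name (h \c g) f).
  have -> : fwd t1 = fwd (phi _ (nm f))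
      \v fwd (value_comp_name h g) \h fwd (n _ _ f).
    by rewrite /= -vcompA -interchange vcomp1m.
  by rewrite vcompA tcomp2E -vcompA -interchange name_compE vcomp1m.
have t2E : tcomp2 (idm #(nm h)) (fwd (name_comp g f)) \v fwd t2
    = fwd (value_comp_name h (g \c f)).
  have -> : fwd t2 = fwd (phi (nm h) _)
      \v fwd (n _ _ h) \h fwd (value_comp_name g f).
    by rewrite /= -vcompA -interchange vcomp1m.
  by rewrite vcompA tcomp2E -vcompA -interchange name_compE vcomp1m.
apply: (fwd_epi (t := t1)).
rewrite -vcompA t1E -vcompA name_compE name_morE.
rewrite -[RHS]vcompA sq12 [RHS]vcompA -(vcompA _ _ (fwd t2)) t2E.
by rewrite name_compE.
Qed.

Lemma name_lunit (A B : C) (f : Hom A B) :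
  name_mor (fwd (lunit f)) \v fwd (name_comp (id1 B) f)
    \v tcomp2 (fwd (name_id B)) (idm #(nm f)) = fwd (tlunit (nm f)).
Proof.
pose t := comp_iso (value_id1l (nm f))
  (comp1_iso (id_iso (id1 B)) (inv_iso (value_name f))).
have tE : tcomp2 (fwd (name_id B)) (idm #(nm f)) \v fwd t
    = fwd (value_comp_name (id1 B) f).
  have -> : fwd t = fwd (phi (wid P B) (nm f))
      \v fwd (value_id P B) \h bwd (value_name f).
    by rewrite /= -vcompA -interchange vcompm1 vcomp1m.
  by rewrite vcompA tcomp2E -vcompA -interchange name_idE vcomp1m.
apply: (fwd_epi (t := t)); rewrite -vcompA tE -vcompA name_compE name_morE.
have -> : fwd t = fwd (value_id1l (nm f))
  \v idm (id1 B) \h bwd (value_name f) by [].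
by rewrite vcompA tlunitE lunit_nat.
Qed.

Lemma name_runit (A B : C) (f : Hom A B) :
  name_mor (fwd (runit f)) \v fwd (name_comp f (id1 A))
    \v tcomp2 (idm #(nm f)) (fwd (name_id A)) = fwd (trunit (nm f)).
Proof.
pose t := comp_iso (value_id1r (nm f))
  (comp1_iso (inv_iso (value_name f)) (id_iso (id1 A))).
have tE : tcomp2 (idm #(nm f)) (fwd (name_id A)) \v fwd t
    = fwd (value_comp_name f (id1 A)).
  have -> : fwd t = fwd (phi (nm f) (wid P A))
      \v bwd (value_name f) \h fwd (value_id P A).
    by rewrite /= -vcompA -interchange vcompm1 vcomp1m.
  by rewrite vcompA tcomp2E -vcompA -interchange name_idE vcomp1m.
apply: (fwd_epi (t := t)); rewrite -vcompA tE -vcompA name_compE name_morE.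
have -> : fwd t = fwd (value_id1r (nm f))
  \v bwd (value_name f) \h idm (id1 A) by [].
by rewrite vcompA trunitE runit_nat.
Qed.

Definition name_pf : pseudofunctor C D :=
  @PseudoFunctor k C D (fun A => A) name_functor
    (fun A B E g f => naming_iso (name_comp g f))
    (fun A => naming_iso (name_id A))
    name_comp_nat name_assoc name_lunit name_runit.

Lemma transport_equivalent : linearly_equivalent C D.
Proof.
exists name_pf, value_pf; split.
  apply: (@icon_equivalent_id k C
    (fun A B => comp_linfunctor (value_functor A B) (name_functor A B)) _ _
    (fun A B f => inv_iso (value_name f))).
  - by move=> A B f f' a; rewrite /= name_morE.
  - by move=> A B E g f /=; rewrite -vcompA; exact: esym (name_compE g f).
  - by move=> A; exact: esym (name_idE A).
apply: (@icon_equivalent_id k D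
  (fun A B => comp_linfunctor (name_functor A B) (value_functor A B)) _ _
  (fun A B f => naming_iso (inv_iso (value_name #f)))).
- by move=> A B f f' a; exact: esym (name_morE a).
- move=> A B E g f; apply: (fwd_epi (t := phi g f)).
  change (bwd (value_name #(g ** f)) \v fwd (phi g f)
    = name_mor (fwd (phi g f)) \v fwd (name_comp #g #f)
      \v tcomp2 (bwd (value_name #g)) (bwd (value_name #f))
      \v fwd (phi g f)).
  have n_phi : tcomp2 (bwd (value_name #g)) (bwd (value_name #f))
      \v fwd (phi g f) = fwd (value_comp_name #g #f).
    by rewrite tcomp2E.
  by rewrite -[RHS]vcompA n_phi -vcompA name_compE name_morE.
move=> A; apply: (fwd_epi (t := value_id P A)).
change (bwd (value_name #(wid P A)) \v fwd (value_id P A)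
  = name_mor (fwd (value_id P A)) \v fwd (name_id A) \v fwd (value_id P A)).
by rewrite -vcompA name_idE name_morE.
Qed.

End TransportEquivalence.

(** * Adjunctions, monads and direct sums in the transported bicategory *)

Section TransportStructure.
Context (k : fieldType) (C : bicat k) (P : presentation C).

Local Notation D := (transport P).
Local Notation W := (word P).
Local Notation "# w" := (value w) (at level 2, w at level 1, format "# w").
Local Notation "q ** p" := (wcomp q p) (at level 40, left associativity).
Local Notation phi := value_comp.
Local Notation nm := (name P).

Lemma tassocVE (A B E E' : C) (h : W E E') (g : W B E) (f : W A B) :
  bwd (tassoc h g f) \v fwd (value_comp3r h g f)
    = fwd (value_comp3l h g f) \v bwd (assoc #h #g #f).
Proof.
apply: (fwd_epi (t := assoc #h #g #f)).
by rewrite -vcompA -tassocE bwd_fwdK vcompm_bwdK.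
Qed.

Section Adjunction.
Context (A B : C) (f : W A B) (g : W B A).

Definition tcomp_unit (u : mor (id1 A) (#g \c #f)) :
    mor #(wid P A) #(g ** f) :=
  fwd (phi g f) \v u \v bwd (value_id P A).

Definition tcomp_counit (c : mor (#f \c #g) (id1 B)) :
    mor #(f ** g) #(wid P B) :=
  fwd (value_id P B) \v c \v bwd (phi f g).

Lemma tcomp_unitE (u : mor (id1 A) (#g \c #f)) :
  tcomp_unit u \v fwd (value_id P A) = fwd (phi g f) \v u.
Proof. exact: vcompm_bwdK. Qed.

Lemma tcomp_counitE (c : mor (#f \c #g) (id1 B)) :
  tcomp_counit c \v fwd (phi f g) = fwd (value_id P B) \v c.
Proof. exact: vcompm_bwdK. Qed.

Lemma tcomp_counit_whisker (c : mor (#f \c #g) (id1 B)) :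
  tcomp2 (tcomp_counit c) (idm #f) \v fwd (value_comp3l f g f)
    = fwd (value_id1l f) \v c \h idm #f.
Proof.
rewrite [LHS]vcompA tcomp2E -vcompA -interchange tcomp_counitE.
by rewrite /= vcomp1m whiskerr_vcomp vcompA.
Qed.

Lemma whisker_tcomp_counit (c : mor (#f \c #g) (id1 B)) :
  tcomp2 (idm #g) (tcomp_counit c) \v fwd (value_comp3r g f g)
    = fwd (value_id1r g) \v idm #g \h c.
Proof.
rewrite [LHS]vcompA tcomp2E -vcompA -interchange tcomp_counitE.
by rewrite /= vcomp1m whiskerl_vcomp vcompA.
Qed.

Lemma tcomp_unit_whisker (u : mor (id1 A) (#g \c #f)) :
  tcomp2 (tcomp_unit u) (idm #g) \v fwd (value_id1l g)
    = fwd (value_comp3l g f g) \v u \h idm #g.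
Proof.
rewrite [LHS]vcompA tcomp2E -vcompA -interchange tcomp_unitE.
by rewrite /= vcomp1m whiskerr_vcomp vcompA.
Qed.

Lemma whisker_tcomp_unit (u : mor (id1 A) (#g \c #f)) :
  tcomp2 (idm #f) (tcomp_unit u) \v fwd (value_id1r f)
    = fwd (value_comp3r f g f) \v idm #f \h u.
Proof.
rewrite [LHS]vcompA tcomp2E -vcompA -interchange tcomp_unitE.
by rewrite /= vcomp1m whiskerl_vcomp vcompA.
Qed.

Lemma tzigzag_l (u : mor (id1 A) (#g \c #f))
    (c : mor (#f \c #g) (id1 B)) :
  fwd (lunit #f) \v (c \h idm #f) \v bwd (assoc #f #g #f)
    \v (idm #f \h u) \v bwd (runit #f) = idm #f ->
  fwd (tlunit f) \v tcomp2 (tcomp_counit c) (idm #f) \v bwd (tassoc f g f)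
    \v tcomp2 (idm #f) (tcomp_unit u) \v bwd (trunit f) = idm #f.
Proof.
move=> zig.
rewrite -[bwd (trunit f)]/(fwd (value_id1r f) \v bwd (runit #f)).
rewrite vcompA -[in LHS](vcompA _ _ (fwd (value_id1r f))) whisker_tcomp_unit.
rewrite [in LHS]vcompA -[in LHS](vcompA _ _ (fwd (value_comp3r f g f))) tassocVE.
rewrite [in LHS]vcompA -[in LHS](vcompA _ _ (fwd (value_comp3l f g f))).
by rewrite tcomp_counit_whisker [in LHS]vcompA tlunitE.
Qed.

Lemma tzigzag_r (u : mor (id1 A) (#g \c #f))
    (c : mor (#f \c #g) (id1 B)) :
  fwd (runit #g) \v (idm #g \h c) \v fwd (assoc #g #f #g)
    \v (u \h idm #g) \v bwd (lunit #g) = idm #g ->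
  fwd (trunit g) \v tcomp2 (idm #g) (tcomp_counit c) \v fwd (tassoc g f g)
    \v tcomp2 (tcomp_unit u) (idm #g) \v bwd (tlunit g) = idm #g.
Proof.
move=> zig.
rewrite -[bwd (tlunit g)]/(fwd (value_id1l g) \v bwd (lunit #g)).
rewrite vcompA -[in LHS](vcompA _ _ (fwd (value_id1l g))) tcomp_unit_whisker.
rewrite [in LHS]vcompA -[in LHS](vcompA _ _ (fwd (value_comp3l g f g))) tassocE.
rewrite [in LHS]vcompA -[in LHS](vcompA _ _ (fwd (value_comp3r g f g))).
by rewrite whisker_tcomp_counit [in LHS]vcompA trunitE.
Qed.

Definition transport_adjunction (adj : adjunction #f #g) :
    @adjunction k D A B f g :=
  @Adjunction k D A B f g
    (tcomp_unit (adj_unit adj)) (tcomp_counit (adj_counit adj))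
    (tzigzag_l (adj_zigzag_l adj)) (tzigzag_r (adj_zigzag_r adj)).

(** The form taken in the transported bicategory by the multiplication of the
    monad of an adjunction, as a 2-morphism of C. *)
Definition twhisk_in (c : mor (#f \c #g) (id1 B)) :
    mor #(g ** f ** (g ** f)) #(g ** f) :=
  tcomp2 (idm #g) (fwd (tlunit f) \v tcomp2 (tcomp_counit c) (idm #f))
    \v (tcomp2 (idm #g) (bwd (tassoc f g f)) \v fwd (tassoc g f (g ** f))).

Lemma twhisk_inE (c : mor (#f \c #g) (id1 B)) :
  twhisk_in c
    \v (fwd (phi (g ** f) (g ** f)) \v fwd (phi g f) \h fwd (phi g f))
  = fwd (phi g f) \v whisk_in c.
Proof.
have sq_assoc := tcomp2_square (erefl (idm #g \v idm #g))
  (tassocVE f g f).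
have sq_counit : fwd (tlunit f) \v tcomp2 (tcomp_counit c) (idm #f)
    \v fwd (value_comp3l f g f)
    = idm #f \v (fwd (lunit #f) \v c \h idm #f).
  by rewrite -vcompA tcomp_counit_whisker vcompA tlunitE vcomp1m.
have := tcomp2_square (erefl (idm #g \v idm #g)) sq_counit.
move/(paste (paste (tassoc_2_2 g f g f) sq_assoc)).
by rewrite comp2_id vcompm1 => ->.
Qed.

End Adjunction.

Lemma transport_has_adjoints : has_adjoints C -> has_adjoints D.
Proof.
move=> adjC A B f; have [ [g [adj_l]] [h [adj_r]]] := adjC A B #f.
move: adj_l adj_r; rewrite -(nameK P g) -(nameK P h) => adj_l adj_r.
by split; [exists (nm g) | exists (nm h)]; constructor;
  exact: transport_adjunction.
Qed.

Section Monad.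
Context (A : C) (p : W A A).

Definition value_mul (m : mor #(p ** p) #p) : mor (#p \c #p) #p :=
  m \v fwd (phi p p).

Definition value_comul (d : mor #p #(p ** p)) :
    mor #p (#p \c #p) :=
  bwd (phi p p) \v d.

Lemma value_mul_whisker (m : mor #(p ** p) #p) :
  tcomp2 m (idm #p) \v fwd (value_comp3l p p p)
    = fwd (phi p p) \v value_mul m \h idm #p.
Proof. by rewrite [LHS]vcompA tcomp2E -vcompA -interchange /= vcomp1m. Qed.

Lemma whisker_value_mul (m : mor #(p ** p) #p) :
  tcomp2 (idm #p) m \v fwd (value_comp3r p p p)
    = fwd (phi p p) \v idm #p \h value_mul m.
Proof. by rewrite [LHS]vcompA tcomp2E -vcompA -interchange /= vcomp1m. Qed.

Lemma value_comul_whisker (d : mor #p #(p ** p)) :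
  tcomp2 d (idm #p) \v fwd (phi p p)
    = fwd (value_comp3l p p p) \v value_comul d \h idm #p.
Proof.
by rewrite tcomp2E /= -vcompA -whiskerr_vcomp fwd_bwdK.
Qed.

Lemma whisker_value_comul (d : mor #p #(p ** p)) :
  tcomp2 (idm #p) d \v fwd (phi p p)
    = fwd (value_comp3r p p p) \v idm #p \h value_comul d.
Proof.
by rewrite tcomp2E /= -vcompA -whiskerl_vcomp fwd_bwdK.
Qed.

Lemma value_is_monad (m : mor #(p ** p) #p) (u : mor #(wid P A) #p) :
  @is_monad k D A p m u -> is_monad (value_mul m) (u \v fwd (value_id P A)).
Proof.
case=> mA mul mur; split.
- have := congr1 (fun x => x \v fwd (value_comp3l p p p)) mA.
  change (m \v tcomp2 m (idm #p) \v fwd (value_comp3l p p p)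
    = m \v tcomp2 (idm #p) m \v fwd (tassoc p p p)
      \v fwd (value_comp3l p p p)
    -> associative_mul (value_mul m)).
  rewrite -vcompA value_mul_whisker vcompA => mA'.
  rewrite /associative_mul {1}/value_mul mA' -vcompA tassocE vcompA.
  by rewrite -(vcompA m) whisker_value_mul vcompA.
- have := congr1 (fun x => x \v fwd (value_id1l p)) mul.
  change (m \v tcomp2 u (idm #p) \v fwd (value_id1l p)
    = fwd (tlunit p) \v fwd (value_id1l p)
    -> value_mul m \v (u \v fwd (value_id P A)) \h idm #p
      = fwd (lunit #p)).
  rewrite tlunitE => <-; rewrite /value_mul -!(vcompA m); congr (_ \v _).
  by rewrite [RHS]vcompA tcomp2E -vcompA -interchange /= vcomp1m.
have := congr1 (fun x => x \v fwd (value_id1r p)) mur.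
change (m \v tcomp2 (idm #p) u \v fwd (value_id1r p)
  = fwd (trunit p) \v fwd (value_id1r p)
  -> value_mul m \v idm #p \h (u \v fwd (value_id P A))
    = fwd (runit #p)).
rewrite trunitE => <-; rewrite /value_mul -!(vcompA m); congr (_ \v _).
by rewrite [RHS]vcompA tcomp2E -vcompA -interchange /= vcomp1m.
Qed.

Lemma value_bimodule_map (m : mor #(p ** p) #p) (d : mor #p #(p ** p)) :
  @bimodule_map k D A p m d -> bimodule_map (value_mul m) (value_comul d).
Proof.
move=> [dmr dml].
have d_phi : fwd (phi p p) \v value_comul d = d by exact: fwd_bwdK.
split; apply: (fwd_mono (t := phi p p)); rewrite vcompA d_phi.
  rewrite {1}/value_mul vcompA.
  have -> : d \v m = tcomp2 m (idm #p) \v bwd (tassoc p p p)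
    \v tcomp2 (idm #p) d by exact: dmr.
  have := paste (paste (whisker_value_comul d) (tassocVE p p p))
    (value_mul_whisker m).
  by rewrite !vcompA.
rewrite {1}/value_mul vcompA.
have -> : d \v m = tcomp2 (idm #p) m \v fwd (tassoc p p p)
  \v tcomp2 d (idm #p) by exact: dml.
have := paste (paste (value_comul_whisker d) (tassocE p p p))
  (whisker_value_mul m).
by rewrite !vcompA.
Qed.

Lemma value_separable (m : mor #(p ** p) #p) :
  @separable k D A p m -> separable (value_mul m).
Proof.
move=> [d [dm md]]; exists (value_comul d).
split; first exact: value_bimodule_map.
by rewrite /value_mul -vcompA fwd_bwdK.
Qed.

Lemma transport_separably_split (m : mor #(p ** p) #p)
    (u : mor #(wid P A) #p) :
  separably_split (value_mul m) (u \v fwd (value_id P A)) ->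
  @separably_split k D A p m u.
Proof.
move=> [B [f]]; rewrite -(nameK P f) => -[g]; rewrite -(nameK P g).
move: (nm f) (nm g) => {}f {}g [adj [ [s cs] [theta [theta_mul theta_unit]]]].
exists B, f, g, (transport_adjunction adj); split.
  exists (fwd (phi f g) \v s \v bwd (value_id P B)).
  change (tcomp_counit (adj_counit adj)
    \v (fwd (phi f g) \v s \v bwd (value_id P B)) = idm #(wid P B)).
  rewrite !vcompA tcomp_counitE -(vcompA _ _ s) cs vcompm1.
  exact: bwdK.
pose t := comp_iso theta (inv_iso (phi g f)).
have tE : fwd t \v fwd (phi g f) = idm #p \v fwd theta.
  by rewrite vcomp1m; exact: vcompm_bwdK.
exists (naming_iso t); split.
  change (fwd t \v twhisk_in (adj_counit adj) = m \v tcomp2 (fwd t) (fwd t)).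
  apply: (fwd_epi (t := comp_iso (phi (g ** f) (g ** f))
    (comp1_iso (phi g f) (phi g f)))).
  rewrite -vcompA twhisk_inE vcompA tE vcomp1m theta_mul.
  by rewrite -[RHS]vcompA (tcomp2_square tE tE) comp2_id vcompm1 vcompA.
change (fwd t \v tcomp_unit (adj_unit adj) = u).
rewrite /tcomp_unit !vcompA tE vcomp1m theta_unit.
exact: vcompm_fwdK.
Qed.

End Monad.

Lemma transport_idempotent_complete2 :
  idempotent_complete2 C -> idempotent_complete2 D.
Proof.
move=> [idemC splitC]; split=> [A B|A p m u monad_p sep_p].
  exact: naming_idempotent_complete (@nameK k C P A B) (idemC A B).
by apply/transport_separably_split/splitC;
  [exact: value_is_monad | exact: value_separable].
Qed.

Lemma transport_has_obj_dirsums : has_obj_dirsums C -> has_obj_dirsums D.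
Proof.
move=> sumC n A; have [S [i [p [pi1 pi0 ip]]]] := sumC n A.
exists S, (fun a => nm (i a)), (fun a => nm (p a)); split=> [a|a b neq_ab|].
- have [t] := pi1 a; constructor; apply: naming_iso.
  apply: comp_iso (value_id P (A a)) (comp_iso t (inv_iso _)).
  exact: value_comp_name.
- have pi_iso := value_comp_name P (p a) (i b).
  exact: (is_zero_iso pi_iso (pi0 a b neq_ab)).
have ip_iso a := value_comp_name P (i a) (p a).
exact: (is_dirsum_iso ip_iso (value_id P S) ip).
Qed.

Lemma transport_simple_obj (A : C) : @simple_obj k D A -> simple_obj A.
Proof.
move/(naming_simple (@nameK k C P A A)).
exact: simple_in_iso (inv_iso (value_id P A)).
Qed.

Lemma transport_equivalent_obj (A B : C) :
  equivalent A B -> @equivalent k D A B.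
Proof.
move=> [f [g [ [gf] [fg]]]]; exists (nm f), (nm g).
by split; constructor; apply: naming_iso;
  apply: comp_iso (value_id P _) (comp_iso _ (inv_iso (value_comp_name P _ _))).
Qed.

Lemma transport_finitely_many_simples :
  finitely_many_simples C -> finitely_many_simples D.
Proof.
move=> [n [S simpleS]]; exists n, S => A /transport_simple_obj /simpleS [i].
by move=> eqv; exists i; apply: transport_equivalent_obj.
Qed.

End TransportStructure.

(** * Formal composites *)

Section FormalComposite.
Context (k : fieldType) (C : bicat k).

(** Paths are nonempty: a 1-morphism is then the value of a path of length one
    on the nose, without a spurious identity factor. *)
Inductive path (A : C) : C -> Type :=
| path1 B : Hom A B -> path A B
| path_cons B D : Hom B D -> path A B -> path A D.

(** The formal identity is kept apart from the path made of the identity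
    1-morphism, as only the former can be a strict unit for concatenation. *)
Inductive formal (A : C) : C -> Type :=
| formal_id : formal A A
| formal_path B : path A B -> formal A B.

Fixpoint path_value A B (p : path A B) : Hom A B :=
  match p with
  | path1 _ f => f
  | path_cons _ _ g q => g \c path_value q
  end.

Fixpoint path_cat A B D (q : path B D) (p : path A B) : path A D :=
  match q in path _ D return path A D with
  | path1 _ g => path_cons g p
  | path_cons _ _ g q' => path_cons g (path_cat q' p)
  end.

Fixpoint path_comp A B D (q : path B D) (p : path A B) :
    iso (path_value q \c path_value p) (path_value (path_cat q p)) :=
  match q in path _ D
  return iso (path_value q \c path_value p) (path_value (path_cat q p)) with
  | path1 _ g => id_iso (g \c path_value p)
  | path_cons _ _ g q' =>
      comp_iso (comp1_iso (id_iso g) (path_comp q' p))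
        (assoc g (path_value q') (path_value p))
  end.

Definition formal_value A B (w : formal A B) : Hom A B :=
  match w with
  | formal_id => id1 A
  | formal_path _ p => path_value p
  end.

Definition formal_extend A B (w : formal A B) D (q : path B D) : formal A D :=
  match w in formal _ B return path B D -> formal A D with
  | formal_id => fun q => formal_path q
  | formal_path _ p => fun q => formal_path (path_cat q p)
  end q.

Definition formal_cat A B D (v : formal B D) (w : formal A B) : formal A D :=
  match v in formal _ D return formal A D with
  | formal_id => w
  | formal_path _ q => formal_extend w q
  end.

Definition formal_extend_comp A B (w : formal A B) D (q : path B D) :
    iso (path_value q \c formal_value w) (formal_value (formal_extend w q)) :=
  match w in formal _ B
  return forall q : path B D,
    iso (path_value q \c formal_value w) (formal_value (formal_extend w q)) with
  | formal_id => fun q => runit (path_value q)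
  | formal_path _ p => fun q => path_comp q p
  end q.

Definition formal_comp A B D (v : formal B D) (w : formal A B) :
    iso (formal_value v \c formal_value w) (formal_value (formal_cat v w)) :=
  match v in formal _ D
  return iso (formal_value v \c formal_value w)
    (formal_value (formal_cat v w)) with
  | formal_id => lunit (formal_value w)
  | formal_path _ q => formal_extend_comp w q
  end.

Definition formal_presentation : presentation C :=
  @Presentation k C formal formal_value
    (fun A B f => formal_path (path1 f)) (fun A B f => erefl)
    formal_id formal_cat (fun A => id_iso (id1 A)) formal_comp.

Local Notation P := formal_presentation.

(** The identity of transported bicategories along an equality of words, read in
    C, where it can be composed with associators. *)
Definition eq_value (X : lincat k) (T : Type) (v : T -> X) (s t : T)
    (e : s = t) : mor (v s) (v t) :=
  @eqmor k (naming v) s t e.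
Arguments eq_value {X T} v {s t} e.

(** Each letter of the outermost path except the last contributes one pentagon;
    the equality of paths is accumulated along the induction, so that no two proofs
    of the same equality have to be compared. *)
Lemma path_assoc A B D E (r : path D E) (q : path B D) (p : path A B) :
  exists e : path_cat (path_cat r q) p = path_cat r (path_cat q p),
    fwd (path_comp r (path_cat q p)) \v idm (path_value r) \h fwd (path_comp q p)
      \v fwd (assoc (path_value r) (path_value q) (path_value p))
    = eq_value (@path_value A E) e
      \v fwd (path_comp (path_cat r q) p)
      \v fwd (path_comp r q) \h idm (path_value p).
Proof.
elim: r q => [X g|X Z g r IH] q.
  exists erefl => /=.
  by rewrite comp2_id vcompm1 !vcomp1m.
have [e IHe] := IH q; exists (congr1 (path_cons g) e).
have -> : eq_value (@path_value A Z) (congr1 (path_cons g) e)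
  = idm g \h eq_value (@path_value A X) e.
  by case: _ / e {IHe}; rewrite /= comp2_id.
rewrite /= whiskerr_vcomp -!vcompA -comp2_id.
rewrite [X in _ \v X = _]vcompA assoc_nat.
rewrite [in RHS](vcompA _ (_ \h _ \h _)) assoc_nat.
rewrite -!vcompA pentagon !vcompA -!whiskerl_vcomp -IHe.
by rewrite !whiskerl_vcomp.
Qed.

(** A formal identity in the first or last position is absorbed by one of Kelly's
    identities, in the middle by the triangle. *)
Lemma formal_assoc A B D E (r : formal D E) (q : formal B D) (p : formal A B) :
  exists e : formal_cat (formal_cat r q) p = formal_cat r (formal_cat q p),
    fwd (@tassoc k C P _ _ _ _ r q p) = eq_value (@formal_value A E) e.
Proof.
suff [e eqe] : exists e : formal_cat (formal_cat r q) p
      = formal_cat r (formal_cat q p),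
    fwd (formal_comp r (formal_cat q p))
      \v idm (formal_value r) \h fwd (formal_comp q p)
      \v fwd (assoc (formal_value r) (formal_value q) (formal_value p))
    = eq_value (@formal_value A E) e \v (fwd (formal_comp (formal_cat r q) p)
      \v fwd (formal_comp r q) \h idm (formal_value p)).
  exists e; apply: (fwd_epi (t := @value_comp3l k C P _ _ _ _ r q p)).
  by rewrite tassocE; exact: eqe.
case: r => [|E' r].
  by exists erefl; rewrite /= vcomp1m lunit_nat -vcompA lunit_comp1.
case: q r => [|D' q] r.
  by exists erefl; rewrite /= vcomp1m -vcompA triangle.
case: p q => [|B' p] q.
  by exists erefl; rewrite /= vcomp1m -vcompA runit_comp1 runit_nat.
have [e path_e] := path_assoc r q p.
exists (congr1 (@formal_path A E') e); rewrite /= path_e -vcompA.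
by congr (_ \v _); case: _ / e {path_e}.
Qed.

Lemma transport_formal_strict : strict (transport P).
Proof.
split=> [A B D E h g f|A B f|A B f].
- exact: formal_assoc.
- exists erefl => /=.
  by rewrite comp2_id vcomp1m bwdK.
case: f => [|B' p]; exists erefl => /=; rewrite comp2_id vcomp1m.
  (* Concatenation contracts two formal identities by the left constraint. *)
  by rewrite -lunit_id1 bwdK.
exact: bwdK.
Qed.

End FormalComposite.

Theorem lemma2p1p5 (k : closedFieldType) (char0 : [pchar k] =i pred0)
    (C : bicat k) :
  (semisimple2 C ->
     exists D : bicat k, strict_semisimple2 D /\ linearly_equivalent C D) /\
  (finite_semisimple2 C ->
     exists D : bicat k, strict_finite_semisimple2 D /\ linearly_equivalent C D).
Proof.
pose P := formal_presentation C; pose D := transport P.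
have strictify : semisimple2 C -> strict_semisimple2 D.
  move=> [ssC adjC [condC addC sumC]].
  split; first exact: transport_formal_strict.
  split=> [A B||A B||].
  - exact: naming_semisimple (@nameK k C P A B) (ssC A B).
  - exact: transport_has_adjoints.
  - exact: naming_additive (@nameK k C P A B) (addC A B).
  - exact: transport_has_obj_dirsums.
  exact/transport_idempotent_complete2/has_condensates_idempotent_complete2.
split=> [ssC | [ssC finC simplesC]]; exists D; split=> //;
  try exact: transport_equivalent; first exact: strictify.
split; [exact: strictify | | exact: transport_finitely_many_simples].
by move=> A B; exact: naming_finite_semisimple (@nameK k C P A B) (finC A B).
Qed.
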